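(* Let $W$ be the Weyl group of type $E_6$. For each $w\in W$ the centraliser $Z_W(w)=\{g\in W : gw=wg\}$ decomposes as a (direct) product of reflection groups.
   Context: A reflection group here means a group isomorphic to a finite subgroup of $GL(V)$ generated by reflections, where $V$ is a finite-dimensional vector space over $\mathbb{R}$, over $\mathbb{C}$, or over the finite field $\mathbb{F}_3$. A reflection of $V$ is a non-identity element of $GL(V)$ of finite order whose fixed subspace is a hyperplane (so over $\mathbb{C}$ these are complex reflections, possibly of order greater than 2). Different factors in the product may be reflection groups over different fields. *)

(* Defs.v *)
From HB Require Import structures.
From mathcomp Require Import all_boot all_order all_fingroup all_algebra.
From mathcomp Require Import all_character complex reals.

Set Implicit Arguments.
Unset Strict Implicit.
Unset Printing Implicit Defensive.

Import GRing.Theory.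
Local Open Scope ring_scope.

(* Matrices act on row vectors from the right, so [eigenspace A 1] is the fixed
   subspace of A. *)
Definition reflection (F : fieldType) (n : nat) (A : 'M[F]_n) : Prop :=
  [/\ A \in unitmx, A != 1%:M, exists2 k : nat, (0 < k)%N & A ^+ k = 1%:M
    & (\rank (eigenspace A 1)).+1 = n].

(* A faithful representation of G on F^n is the same thing as an isomorphism
   of G onto a finite subgroup of GL_n(F). *)
Definition reflection_group_over (F : fieldType) (gT : finGroupType)
    (G : {group gT}) : Prop :=
  exists (n : nat) (rG : mx_representation F G n),
    mx_faithful rG /\
    exists S : {set gT},
      <<S>>%g = G /\ forall g, g \in S -> reflection (rG g).

Definition reflection_group (R : realType) (gT : finGroupType)
    (G : {group gT}) : Prop :=
  [\/ reflection_group_over R G, reflection_group_over R[i] G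
    | reflection_group_over 'F_3 G].

(* Bourbaki's labelling with indices shifted by one: the diagram is the path
   0 - 2 - 3 - 4 - 5 with the extra node 1 attached to 3. *)
Definition E6_edge (i j : nat) : bool :=
  (i, j) \in [:: (0, 2); (2, 3); (3, 4); (4, 5); (1, 3)]%N.

Definition E6_coef (i j : nat) : int :=
  if i == j then 2 else if E6_edge i j || E6_edge j i then -1 else 0.

Definition E6 : 'M[int]_6 := \matrix_(i, j) E6_coef i j.

(* In the basis of simple roots, the reflection a_j |-> a_j - C_ji a_i; row j
   of the matrix holds the coordinates of the image of a_j. *)
Definition simple_reflection (n : nat) (C : 'M[int]_n) (i : 'I_n) : 'M[rat]_n :=
  \matrix_(j, k) ((j == k)%:R - (C j i)%:~R * (i == k)%:R).

(* W is isomorphic to the subgroup of GL_n(Q) generated by the simple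
   reflections of the root system with Cartan matrix C. *)
Definition weyl_group (n : nat) (C : 'M[int]_n) (gT : finGroupType)
    (W : {group gT}) : Prop :=
  exists rW : mx_representation rat W n,
    mx_faithful rW /\
    exists s : 'I_n -> gT,
      <<[set s i | i : 'I_n]>>%g = W /\
      forall i, rW (s i) = simple_reflection C i.

(* The rest of this file shows that the hypothesis [weyl_group E6 W] is
   satisfiable: the simple reflections permute the finite root system, and the
   permutation group they generate has the required matrix representation.
   Roots are given by their coordinates in the basis of simple roots. *)
Definition E6_refl (i : nat) (v : seq int) : seq int :=
  set_nth 0 v i (v`_i - foldr (fun j a => v`_j * E6_coef j i + a) 0 (iota 0 6)).

Definition E6_simple_root (i : nat) : seq int := mkseq (fun j => (j == i)%:R) 6.

Definition E6_root_system (s : seq (seq int)) : bool :=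
  all (fun v => (size v == 6) &&
      all (fun i => (E6_refl i v \in s) && (E6_refl i (E6_refl i v) == v))
        (iota 0 6)) s
  && all (mem s) (mkseq E6_simple_root 6).

(* Opaque, so that the explicit list of the 72 roots never gets unfolded. *)
Fact E6_roots_sig : {s : seq (seq int) | E6_root_system s}.
Proof.
exists (iter 11 (fun s => undup (s ++ [seq E6_refl i v | i <- iota 0 6, v <- s]))
  (mkseq E6_simple_root 6)).
by vm_compute.
Qed.

Definition E6_roots : seq (seq int) := sval E6_roots_sig.

Definition E6_root := seq_sub E6_roots.

Lemma E6_rootP (v : E6_root) (i : 'I_6) :
  [/\ size (val v) = 6%N, E6_refl i (val v) \in E6_roots
    & E6_refl i (E6_refl i (val v)) = val v].
Proof.
have hi : (i : nat) \in iota 0 6 by rewrite mem_iota ltn_ord.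
have /andP[/allP hv _] := svalP E6_roots_sig.
by have /andP[/eqP sv /allP/(_ _ hi)/andP[h /eqP e]] := hv _ (valP v).
Qed.

Definition E6_act (i : 'I_6) (v : E6_root) : E6_root :=
  insubd v (E6_refl i (val v)).

Lemma val_E6_act i v : val (E6_act i v) = E6_refl i (val v).
Proof. by case: (E6_rootP v i) => _ h _; rewrite /E6_act val_insubd h. Qed.

Lemma E6_actK i : involutive (E6_act i).
Proof. by move=> v; apply: val_inj; rewrite !val_E6_act; case: (E6_rootP v i). Qed.

Definition E6_perm i : {perm E6_root} := perm (inv_inj (E6_actK i)).

Lemma E6_simple_in (i : 'I_6) : E6_simple_root i \in E6_roots.
Proof.
have /andP[_ /allP] := svalP E6_roots_sig; apply.
by apply: (map_f E6_simple_root); rewrite mem_iota ltn_ord.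
Qed.

Definition E6_simple (i : 'I_6) : E6_root := SeqSub (E6_simple_in i).

Definition E6_vec (v : E6_root) : 'rV[rat]_6 := \row_j ((val v)`_j)%:~R.

Lemma E6_vec_inj : injective E6_vec.
Proof.
move=> u v e; apply: val_inj; case: (E6_rootP u ord0) => su _ _.
case: (E6_rootP v ord0) => sv _ _.
apply: (@eq_from_nth _ 0); rewrite su ?sv // => i lti.
by have /rowP/(_ (Ordinal lti)) := e; rewrite !mxE => /intr_inj.
Qed.

Lemma E6_vec_simple i : E6_vec (E6_simple i) = delta_mx 0 i.
Proof.
apply/rowP=> j; rewrite !mxE /= /E6_simple_root nth_mkseq //=.
by rewrite -(inj_eq val_inj) /=; case: eqP.
Qed.

Lemma E6_vec_act i v :
  E6_vec (E6_act i v) = E6_vec v *m simple_reflection E6 i.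
Proof.
apply/rowP=> k; rewrite mxE val_E6_act /E6_refl nth_set_nth /=.
rewrite mxE (eq_bigr (fun j : 'I_6 => ((val v)`_j)%:~R * (j == k)%:R
   - ((val v)`_j * E6_coef j i)%:~R * (i == k)%:R)); last first.
  by move=> j _; rewrite !mxE mulrBr intrM mulrA.
rewrite sumrB (bigD1 k) //= eqxx mulr1 big1 ?addr0; last first.
  by move=> j /negPf->; rewrite mulr0.
rewrite eq_sym -val_eqE; case: eqP => [ik|_]; last first.
  by rewrite big1 ?subr0 // => j _; rewrite mulr0.
rewrite -ik rmorphB /=; congr (_ - _).
under eq_bigr do rewrite mulr1.
rewrite -[RHS]rmorph_sum /=; congr (_%:~R); rewrite !big_ord_recl big_ord0 /=.
by rewrite addr0.
Qed.

Definition E6_mx (p : {perm E6_root}) : 'M[rat]_6 :=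
  \matrix_i E6_vec (p (E6_simple i)).

Definition E6_linear : {set {perm E6_root}} :=
  [set p : {perm E6_root} | [forall v, E6_vec (p v) == E6_vec v *m E6_mx p]].

Lemma E6_linearP p : p \in E6_linear ->
  forall v, E6_vec (p v) = E6_vec v *m E6_mx p.
Proof. by rewrite inE => /forallP h v; apply/eqP. Qed.

Lemma E6_mx1 : E6_mx 1 = 1%:M.
Proof. by apply/row_matrixP=> i; rewrite rowK perm1 E6_vec_simple row1. Qed.

Lemma E6_mxM p q : q \in E6_linear -> E6_mx (p * q) = E6_mx p *m E6_mx q.
Proof.
move=> /E6_linearP hq; apply/row_matrixP=> i.
by rewrite row_mul !rowK permM hq.
Qed.

Lemma E6_linear_group_set : group_set E6_linear.
Proof.
apply/group_setP; split.
  by rewrite inE; apply/forallP=> v; rewrite perm1 E6_mx1 mulmx1.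
move=> p q hp hq; rewrite inE; apply/forallP=> v.
by rewrite E6_mxM // permM (E6_linearP hq) (E6_linearP hp) mulmxA.
Qed.
Canonical E6_linear_group := Group E6_linear_group_set.

Lemma E6_mx_perm i : E6_mx (E6_perm i) = simple_reflection E6 i.
Proof.
apply/row_matrixP=> j.
by rewrite rowK permE E6_vec_act E6_vec_simple -rowE.
Qed.

Lemma weyl_group_E6_exists :
  exists (gT : finGroupType) (W : {group gT}), weyl_group E6 W.
Proof.
pose W := <<[set E6_perm i | i : 'I_6]>>%G.
have sW : W \subset E6_linear.
  rewrite gen_subG; apply/subsetP=> _ /imsetP[i _ ->]; rewrite inE.
  by apply/forallP=> v; rewrite E6_mx_perm permE E6_vec_act.
have rP : mx_repr W E6_mx.
  split=> [|p q _ Wq]; first exact: E6_mx1.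
  by apply: E6_mxM; apply: (subsetP sW).
exists _, W, (MxRepresentation rP); split; last first.
  by exists E6_perm; split=> // i; apply: E6_mx_perm.
apply/subsetP=> p; rewrite !inE mul1mx => /andP[Wp /eqP /= p1].
apply/eqP/permP=> v; rewrite perm1; apply: E6_vec_inj.
by rewrite (E6_linearP (subsetP sW _ Wp)) p1 mulmx1.
Qed.

(* Main.v *)
From Stdlib Require Import NArith.
Require Import Defs.
From mathcomp Require Import all_boot all_order all_fingroup all_algebra.
From mathcomp Require Import all_solvable all_field.
From mathcomp Require Import all_character complex reals ring.

(** The group W acts on the 27 lines of the cubic surface, that is, on the orbit
    of the first fundamental weight, faithfully and preserving the relation
    between two lines (equal, skew or meeting). Everything about W is computed
    inside this action, where an element is a list of 27 images.

    Bounding centralisers. An element g that commutes with w and fixes a line f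
    fixes every w^a f; hence it sends another line b to a line x that is related
    to these fixed lines as b is, and to its own translates w^a x as b is to
    w^a b. Going through a base of lines one by one and multiplying the numbers
    of candidates x gives an upper bound for |C_W(w)|. If at each step the
    candidates are moreover one orbit of elements of a known subgroup H of
    C_W(w) that fix the earlier lines, then each element of C_W(w) can be
    divided by elements of H until it fixes all lines, so that C_W(w) = H
    ([siftP]).

    All classes are met. The bounds c_i of 25 elements w_i satisfy
    sum 1 / c_i = 1. No two of the w_i are conjugate: for the first, second or
    third powers, the numbers of lines that are fixed, or skew to their images,
    differ. As a class has at least |W| / c_i elements, the
    25 classes fill W ([class_table_complete]).

    The decompositions. For each w_i the subgroup H is given by generators of
    its direct factors. Factors commute because their generators do, and two
    factors meet trivially because an element of both is central in H and stays
    in the orbits of both factors, which leaves only one candidate for the image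
    of each line ([independentP]). A cyclic factor is a complex reflection group
    of rank one. Any other factor acts on a submodule of the module of functions
    on the 27 lines, over C or over F_3, in which its generators are reflections
    ([line_reflection_group]). The submodule consists of linear forms, restricted
    to the lines: all of them for factors generated by reflections of W, those
    in an eigenspace of w_i for the other factors, as in the theory of regular
    elements; this gives W(B_2), W(B_3), W(F_4), the complex groups G(3,1,2),
    G_5, G_8 and G_25, and S_3 in two cases. The one exception is the factor
    S_3 wr Z_2 in the centraliser of the product of two adjacent simple
    reflections: it permutes nine lines as affine transformations of the plane
    over F_3, and the affine functions on this plane are a module of rank three
    in which translations are transvections. *)

Set Implicit Arguments.
Unset Strict Implicit.
Unset Printing Implicit Defensive.

Import GRing.Theory Num.Theory GroupScope.
Local Open Scope ring_scope.

(** * Reflections in submodules *)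

Lemma matrix_exp_order (F : fieldType) (gT : finGroupType) (G : {group gT})
    (n : nat) (rG : mx_representation F G n) (g : gT) :
  g \in G -> rG g ^+ #[g] = 1%:M.
Proof.
move=> Gg; have e k : rG g ^+ k = rG (g ^+ k)%g.
  elim: k => [|k IH]; first by rewrite expg0 repr_mx1.
  by rewrite exprS IH expgS repr_mxM ?groupX.
by rewrite e expg_order repr_mx1.
Qed.

Lemma reflection_of_rank1 (F : fieldType) (n : nat) (A : 'M[F]_n)
    (c : 'cV[F]_n) (r : 'rV[F]_n) (k : nat) :
    A = 1%:M + c *m r -> c != 0 -> r != 0 -> (0 < k)%N -> A ^+ k = 1%:M ->
  reflection A.
Proof.
move=> eA c0 r0 k0 Ak.
have rk : \rank (A - 1%:M) = 1%N.
  apply/eqP; rewrite eqn_leq; apply/andP; split.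
    rewrite eA addrC addKr.
    exact: leq_trans (mxrankM_maxr _ _) (rank_leq_row _).
  rewrite lt0n mxrank_eq0 eA addrC addKr.
  apply: contraNneq c0 => cr0; apply/eqP.
  have /rV0Pn [j rj] := r0; apply/colP=> i; rewrite mxE.
  have /matrixP/(_ i j) := cr0; rewrite !mxE big_ord1 => /eqP.
  by rewrite mulf_eq0 (negPf rj) orbF => /eqP.
split.
- case: k k0 Ak => // k _; rewrite exprS => Ak.
  by case/mulmx1_unit: Ak.
- by apply/eqP=> A1; rewrite A1 subrr mxrank0 in rk.
- by exists k.
- rewrite /eigenspace mxrank_ker rk.
  by have := rank_leq_row (A - 1%:M); rewrite rk; case: (n) => // m _; rewrite subn1.
Qed.

Lemma primitive_root_exists (F : closedFieldType) (n : nat) :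
  n%:R != 0 :> F -> exists z : F, n.-primitive_root z.
Proof.
move=> nF0; have n0 : (0 < n)%N by case: n nF0 => //; rewrite eqxx.
pose p : {poly F} := 'X^n - 1; have [r Dp] := closed_field_poly_normal p.
rewrite (monicP _) ?monicXnsubC // scale1r in Dp.
have rn1 : all n.-unity_root r by apply/allP=> z; rewrite -root_prod_XsubC -Dp.
have sz_r : (n < (size r).+1)%N.
  by rewrite -(size_prod_XsubC r id) -Dp size_XnsubC.
have [|z] := hasP (has_prim_root n0 rn1 _ sz_r); last by exists z.
by rewrite -separable_prod_XsubC -Dp separable_Xn_sub_1.
Qed.

(** A generator x acts on a line as multiplication by a primitive #[x]-th root of
    unity, which is a reflection of a one-dimensional space. The trivial group is
    the reflection group of the zero space. *)
Lemma cyclic_reflection_group (F : closedFieldType) (gT : finGroupType)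
    (x : gT) :
  #[x]%:R != 0 :> F -> reflection_group_over F <[x]>.
Proof.
have [-> _|x1 nF0] := eqVneq x 1%g.
  have rP : mx_repr (<[1%g]> : {set gT}) (fun _ : gT => 1%:M : 'M[F]_0).
    by split=> // g h _ _; rewrite mulmx1.
  exists 0%N, (MxRepresentation rP); split.
    by apply/subsetP=> g; rewrite inE => /andP[/cycleP[i ->]]; rewrite expg1n.
  by exists set0; split=> [|g]; rewrite ?gen0 ?inE // -cycle1.
have [z prim_z] := primitive_root_exists nF0.
pose dlog g := index g [seq (x ^+ i)%g | i <- iota 0 #[x]].
have dlogK g : g \in <[x]> -> (x ^+ dlog g)%g = g.
  move=> /cyclePmin [i lti ->].
  have h : (x ^+ i)%g \in [seq (x ^+ i)%g | i <- iota 0 #[x]].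
    by apply: map_f; rewrite mem_iota add0n lti.
  have /(nth_map 0%N 1%g (fun j => (x ^+ j)%g)) : (dlog (x ^+ i)%g < size (iota 0 #[x]))%N.
    by rewrite -(size_map (fun i => (x ^+ i)%g)) index_mem.
  rewrite nth_index // nth_iota ?add0n //.
  by move: h; rewrite -index_mem size_map size_iota.
pose r g : 'M[F]_1 := (z ^+ dlog g)%:M.
have rX i : r (x ^+ i)%g = (z ^+ i)%:M.
  have /eqP := dlogK _ (mem_cycle x i); rewrite eq_expg_mod_order => h.
  by rewrite /r; congr _%:M; apply/eqP; rewrite (eq_prim_root_expr prim_z).
have rP : mx_repr (<[x]> : {set gT}) r.
  split=> [|g h /cycleP[i ->] /cycleP[j ->]]; first by rewrite -(expg0 x) rX.
  by rewrite -expgD !rX exprD scalar_mxM.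
exists 1%N, (MxRepresentation rP); split.
  apply/subsetP=> g; rewrite !inE mul1mx => /andP[/cycleP[i ->] /eqP /=].
  rewrite rX => /matrixP/(_ 0 0); rewrite !mxE !mulr1n => /eqP.
  by rewrite -(expr0 z) (eq_prim_root_expr prim_z) -eq_expg_mod_order expg0.
exists [set x]; split=> // g; rewrite inE => /eqP-> /=.
have rx : r x = z%:M by rewrite -{1}(expg1 x) rX expr1.
have z1 : z - 1 != 0.
  rewrite subr_eq0; apply: contraNneq x1 => zE.
  by rewrite -order_eq1 -dvdn1 (prim_order_dvd prim_z) expr1 zE.
have xx := cycle_id x.
apply: (@reflection_of_rank1 _ _ _ (z - 1)%:M 1%:M #[x]).
- by rewrite rx mulmx1 -rmorphD addrC subrK.
- by apply: contraNneq z1 => /matrixP/(_ 0 0); rewrite !mxE mulr1n => ->.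
- by apply/eqP=> /matrixP/(_ 0 0); rewrite !mxE mulr1n => /eqP; rewrite oner_eq0.
- exact: order_gt0.
- exact: (matrix_exp_order (MxRepresentation rP)).
Qed.

(** The rows of L span a submodule on which g acts by the matrix rho g with
    L g = (rho g) L. It is enough to see that the submodule is invariant on
    generators, where the hypothesis exhibits rho g as the identity plus a matrix
    of rank one. *)
Lemma submodule_reflection_group (F : fieldType) (gT : finGroupType)
    (G H : {group gT}) (n k : nat) (rG : mx_representation F G n)
    (L : 'M[F]_(k, n)) (S : {set gT}) :
    H \subset G -> <<S>>%g = H -> row_free L ->
    (forall g, g \in S -> exists (c : 'cV[F]_k) (r : 'rV[F]_k),
       [/\ c != 0, r != 0 & L *m rG g = (1%:M + c *m r) *m L]) ->
    (forall g, g \in H -> L *m rG g = L -> g = 1%g) ->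
  reflection_group_over F H.
Proof.
move=> sHG genS /row_freeP [X LX] hS faith.
pose rho g := L *m rG g *m X.
have rhoL g : g \in H -> L *m rG g = rho g *m L.
  pose K := [set g in H | L *m rG g == rho g *m L].
  have gK : group_set K.
    apply/group_setP; split.
      by rewrite inE group1 /rho repr_mx1 mulmx1 LX mul1mx eqxx.
    move=> a b; rewrite !inE => /andP[Ha /eqP ea] /andP[Hb /eqP eb].
    have e : L *m rG (a * b)%g = rho a *m rho b *m L.
      by rewrite repr_mxM ?(subsetP sHG) // mulmxA ea -mulmxA eb mulmxA.
    by rewrite groupM //= [rho (a * b)%g]/rho e -[_ *m L *m X]mulmxA LX mulmx1.
  have sSK : S \subset Group gK.
    apply/subsetP=> a Sa; rewrite inE -genS mem_gen //=.
    have [c [r [_ _ e]]] := hS _ Sa.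
    by rewrite /rho e -[_ *m L *m X]mulmxA LX mulmx1.
  by rewrite -genS => /(subsetP (_ : <<S>>%g \subset Group gK));
     rewrite gen_subG inE => /(_ sSK)/andP[_ /eqP].
have rP : mx_repr H rho.
  split=> [|a b Ha Hb]; first by rewrite /rho repr_mx1 mulmx1.
  by rewrite {1}/rho repr_mxM ?(subsetP sHG) // mulmxA rhoL // /rho !mulmxA.
exists k, (MxRepresentation rP); split.
  apply/subsetP=> a; rewrite !inE mul1mx => /andP[Ha /eqP /= e].
  by apply/eqP/faith; rewrite // rhoL // e mul1mx.
exists S; split=> // a Sa /=; have Ha : a \in H by rewrite -genS mem_gen.
have [c [r [c0 r0 e]]] := hS _ Sa.
apply: (@reflection_of_rank1 _ _ _ c r #[a]) => //.
- by rewrite /rho e -[_ *m L *m X]mulmxA LX mulmx1.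
- exact: (matrix_exp_order (MxRepresentation rP)).
Qed.

(** * Permutation codes and the sifting of centralisers *)

Local Close Scope ring_scope.

Section Codes.
Local Open Scope nat_scope.
Variables (N : nat) (rel : nat -> nat -> nat).

Definition code_at (p : seq nat) (k : nat) : nat := nth 0 p k.

(** Words are read from left to right and act on the right; an index outside the
    list stands for the identity, as it does in [gprod]. *)
Definition compose (ps : seq (seq nat)) (u : seq nat) : seq nat :=
  foldl (fun p i => [seq code_at (nth (iota 0 N) ps i) k | k <- p]) (iota 0 N) u.

Definition code_commute (p q : seq nat) : bool :=
  all (fun k => code_at p (code_at q k) == code_at q (code_at p k)) (iota 0 N).

Fixpoint reach (ps : seq (seq nat)) (fuel : nat) (todo seen : seq nat) :
    seq nat :=
  if fuel is fuel'.+1 then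
    if todo is x :: todo' then
      let new := undup [seq y <- [seq code_at p x | p <- ps] | y \notin seen] in
      reach ps fuel' (todo' ++ new) (seen ++ new)
    else seen
  else seen.

(** Each step removes one point from the list of points to visit, and a point
    enters that list once: N steps are enough. *)
Definition code_orbit (ps : seq (seq nat)) (b : nat) : seq nat :=
  reach ps N [:: b] [:: b].

(** Closed sets contain the orbits; unlike [reach], this condition bounds orbits
    from above and does not depend on the number of steps of the search. *)
Definition orbits_closed (ps : seq (seq nat)) (orbs : seq (seq nat)) : bool :=
  all (fun k => let O := nth [::] orbs k in
         (k \in O) && all (fun x => all (fun p => code_at p x \in O) ps) O)
      (iota 0 N).

(** The possible images of b under an element g that fixes F, commutes with the
    permutations in T, preserves [rel] and satisfies P k (g k) for all k. *)
Definition cands (P : nat -> nat -> bool) (T : seq (seq nat)) (F : seq nat)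
    (b : nat) : seq nat :=
  [seq x <- iota 0 N | [&& P b x, all (fun f => rel f x == rel f b) F
     & all (fun t => rel x (code_at t x) == rel b (code_at t b)) T]].

Definition grow P T (F : seq nat) : seq nat :=
  [seq k <- iota 0 N | (k \in F) || all (pred1 k) (cands P T F k)].

(** Three rounds suffice for the groups considered here; the points found in one
    round restrict the candidates of the next one. *)
Definition rigid P T : bool := iter 3 (grow P T) [::] == iota 0 N.

(** A level is a base point b and permutations that fix the points fixed before
    and move b to all of its candidates. Once b is fixed, so are its images
    under T. After the last level the points outside F must have no other
    candidate than themselves. *)
Fixpoint sift T F (levels : seq (nat * seq (seq nat))) : bool :=
  if levels is (b, ps) :: levels' then
    [&& b < N, all (mem (code_orbit ps b)) (cands (fun _ _ => true) T F b),
        all (fun p => all (fun f => code_at p f == f) F) ps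
      & sift T (F ++ b :: [seq code_at t b | t <- T]) levels']
  else iter 2 (grow (fun _ _ => true) T) F == iota 0 N.

Fixpoint sift_sizes T F (levels : seq (nat * seq (seq nat))) : seq nat :=
  if levels is (b, _) :: levels' then
    size (cands (fun _ _ => true) T F b)
      :: sift_sizes T (F ++ b :: [seq code_at t b | t <- T]) levels'
  else [::].

End Codes.

Record point_action (N : nat) (rel : nat -> nat -> nat) (gT : finGroupType)
    (W : {group gT}) (mv : gT -> nat -> nat) : Prop := PointAction {
  pt_lt : forall g k, g \in W -> k < N -> mv g k < N;
  pt1 : forall k, k < N -> mv 1 k = k;
  ptM : forall g h k, g \in W -> h \in W -> k < N ->
    mv (g * h) k = mv h (mv g k);
  pt_rel : forall g i j, g \in W -> i < N -> j < N ->
    rel (mv g i) (mv g j) = rel i j;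
  pt_faithful : forall g, g \in W -> (forall k, k < N -> mv g k = k) -> g = 1
}.

Definition gprod (gT : finGroupType) (gs : seq gT) (u : seq nat) : gT :=
  \prod_(i <- u) nth 1 gs i.

Lemma gprod_gen (gT : finGroupType) (gs : seq gT) u :
  gprod gs u \in <<[set:: gs]>>.
Proof.
apply: group_prod => i _; have [lti|gei] := ltnP i (size gs).
  by rewrite mem_gen // inE mem_nth.
by rewrite nth_default.
Qed.

Section PointAction.
Variables (N : nat) (rel : nat -> nat -> nat) (gT : finGroupType).
Variables (W : {group gT}) (mv : gT -> nat -> nat).
Hypothesis act : point_action N rel W mv.

Definition codes (p : seq nat) (g : gT) : Prop :=
  forall k, k < N -> mv g k = code_at p k.

Lemma codes_compose (gs : seq gT) (ps : seq (seq nat)) (u : seq nat) :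
    size ps = size gs -> {subset gs <= W} ->
    (forall i, i < size gs -> codes (nth [::] ps i) (nth 1 gs i)) ->
  codes (compose N ps u) (gprod gs u).
Proof.
move=> sz sW hc; elim/last_ind: u => [|u i IH] k ltk.
  by rewrite /gprod big_nil (pt1 act) //= /code_at nth_iota.
have uW v : gprod gs v \in W.
  by apply: (subsetP _ _ (gprod_gen gs v)); rewrite gen_subG; apply/subsetP=> g;
     rewrite inE => /sW.
rewrite /gprod -cats1 big_cat big_seq1 /= -/(gprod gs u).
have iW : nth 1 gs i \in W.
  have [lti|gei] := ltnP i (size gs); first by rewrite sW ?mem_nth.
  by rewrite nth_default ?group1.
rewrite (ptM act) // /compose foldl_cat /= /code_at (nth_map 0); last first.
  have szc v : size (compose N ps v) = N.
    elim/last_ind: v => [|v j IHv]; first by rewrite size_iota.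
    by rewrite /compose -cats1 foldl_cat /= size_map.
  by rewrite szc.
have := IH k ltk; rewrite /code_at /compose => <-.
have ltg := pt_lt act (uW u) ltk.
have [lti|gei] := ltnP i (size gs).
  by rewrite hc // (set_nth_default [::]) ?sz.
by rewrite (nth_default 1) // (nth_default (iota 0 N)) ?sz // (pt1 act) // nth_iota.
Qed.

Lemma pt_inj g h : g \in W -> h \in W ->
  (forall k, k < N -> mv g k = mv h k) -> g = h.
Proof.
move=> gW hW e; apply: (mulIg h^-1); rewrite mulgV.
apply: (pt_faithful act) => [|k ltk]; first by rewrite groupM ?groupV.
by rewrite (ptM act) ?groupV // e // -(ptM act) ?groupV // mulgV (pt1 act).
Qed.

Lemma codes_commute p q g h : g \in W -> h \in W -> codes p g -> codes q h ->
  code_commute N p q -> commute g h.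
Proof.
move=> gW hW cg ch /allP hpq; apply: pt_inj; rewrite ?groupM // => k ltk.
rewrite !(ptM act) // (cg _ ltk) (ch _ ltk) ch ?cg.
- by apply/esym/eqP/hpq; rewrite mem_iota.
- by rewrite -ch ?(pt_lt act).
- by rewrite -cg ?(pt_lt act).
Qed.

Lemma pt_transport g h x y : g \in W -> h \in W -> x < N ->
  mv g x = y -> mv h x = y -> mv (g * h^-1) x = x.
Proof.
move=> gW hW ltx gx hx.
by rewrite (ptM act) ?groupV // gx -hx -(ptM act) ?groupV // mulgV (pt1 act).
Qed.

(** The search only applies elements of K, so that all points that it meets are
    in one K-orbit, whether or not it has run to its end. *)
Lemma reachP (K : {group gT}) (ps : seq (seq nat)) (b : nat) :
    K \subset W -> b < N -> (forall p, p \in ps -> exists2 g, g \in K & codes p g) ->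
  forall x, x \in code_orbit N ps b -> exists2 g, g \in K & mv g b = x.
Proof.
move=> sKW ltb hps; pose R x := exists2 g, g \in K & mv g b = x.
suff main n todo seen : (forall x, x \in todo -> R x) ->
    (forall x, x \in seen -> R x) -> forall x, x \in reach ps n todo seen -> R x.
  by move=> x; apply: main => y; rewrite inE => /eqP->; exists 1; rewrite ?(pt1 act).
elim: n todo seen => [|n IH] [|x todo] seen //= htodo hseen.
set new := undup _.
have hnew y : y \in new -> R y.
  rewrite mem_undup mem_filter => /andP[_ /mapP [p pps ->]].
  have [g gK cg] := hps _ pps; have [h hK hx] := htodo x (mem_head _ _).
  exists (h * g); first exact: groupM.
  by rewrite (ptM act) ?(subsetP sKW) // hx cg // -hx (pt_lt act) ?(subsetP sKW).
apply: IH => y; rewrite mem_cat => /orP[]; auto.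
by move=> ytodo; apply: htodo; rewrite inE ytodo orbT.
Qed.

Lemma orbits_closedP (gs : seq gT) (ps : seq (seq nat)) (orbs : seq (seq nat)) :
    {subset gs <= W} -> (forall g, g \in gs -> exists2 p, p \in ps & codes p g) ->
    orbits_closed N ps orbs ->
  forall g k, g \in <<[set:: gs]>> -> k < N -> mv g k \in nth [::] orbs k.
Proof.
move=> sW hgs /allP hO.
pose K := [set g in W | [forall k : 'I_N, forall x : 'I_N,
  ((x : nat) \in nth [::] orbs k) ==> (mv g x \in nth [::] orbs k)]].
have KP g : g \in K -> g \in W /\ forall k x, k < N -> x < N ->
    x \in nth [::] orbs k -> mv g x \in nth [::] orbs k.
  rewrite inE => /andP[gW /forallP h]; split=> // k x ltk ltx.
  by move: (h (Ordinal ltk)) => /forallP/(_ (Ordinal ltx))/implyP.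
have gK : group_set K.
  apply/group_setP; split.
    rewrite inE group1; apply/forallP=> k; apply/forallP=> x; apply/implyP.
    by rewrite (pt1 act).
  move=> g h /KP [gW hg] /KP [hW hh]; rewrite inE groupM //=.
  apply/forallP=> k; apply/forallP=> x; apply/implyP=> xk.
  by rewrite (ptM act) // hh ?hg ?(pt_lt act).
have sK : <<[set:: gs]>> \subset Group gK.
  rewrite gen_subG; apply/subsetP=> g; rewrite !inE => ggs; rewrite sW //=.
  have [p pps cp] := hgs _ ggs.
  apply/forallP=> k; apply/forallP=> x; apply/implyP=> xk.
  have := hO k; rewrite mem_iota /= => /(_ (ltn_ord k))/andP[_ /allP/(_ _ xk)].
  by move=> /allP/(_ _ pps); rewrite cp.
move=> g k /(subsetP sK)/KP [_ h] ltk; apply: h => //.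
by have := hO k; rewrite mem_iota => /(_ ltk)/andP[].
Qed.

Section Stabilisers.
Variables (A : {group gT}) (T : seq (seq nat)) (P : nat -> nat -> bool).
Hypothesis sAW : A \subset W.
Hypothesis hT : forall t, t \in T -> forall k, k < N -> code_at t k < N /\
  forall g, g \in A -> mv g (code_at t k) = code_at t (mv g k).
Hypothesis hP : forall g k, g \in A -> k < N -> P k (mv g k).

Definition stab (F : seq nat) : {set gT} :=
  [set g in A | all (fun f => mv g f == f) F].

Lemma stabP F g :
  reflect (g \in A /\ forall f, f \in F -> mv g f = f) (g \in stab F).
Proof.
rewrite inE; apply: (iffP andP) => [[gA /allP h]|[gA h]]; split=> //.
  by move=> f /h/eqP.
by apply/allP=> f /h ->.
Qed.

Lemma stab_group_set F : all (gtn N) F -> group_set (stab F).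
Proof.
move=> /allP ltF; apply/group_setP; split.
  by apply/stabP; split=> // f fF; rewrite (pt1 act) //; apply: ltF.
move=> g h /stabP [gA hg] /stabP [hA hh]; apply/stabP; split.
  exact: groupM.
move=> f fF; rewrite (ptM act) ?(subsetP sAW) ?hg ?hh //; exact: ltF.
Qed.

(** Commutation gives g (t b) = t (g b), so the relation of b with t b carries
    over to g b and t (g b); the points of F do not move, so the relation of b
    with them carries over to g b as well. *)
Lemma candsP F b g : all (gtn N) F -> b < N -> g \in stab F ->
  mv g b \in cands N rel P T F b.
Proof.
move=> /allP ltF ltb /stabP [gA hg]; have gW := subsetP sAW _ gA.
rewrite mem_filter mem_iota /= add0n (pt_lt act) // hP // andbT /=.
apply/andP; split; apply/allP=> f fF.
  by rewrite -{1}(hg _ fF) (pt_rel act) //; apply: ltF.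
have [lttb htb] := hT fF ltb.
by rewrite -htb // (pt_rel act).
Qed.

Lemma growP F g : all (gtn N) F -> g \in stab F -> g \in stab (grow N rel P T F).
Proof.
move=> ltF gF; have /stabP [gA hg] := gF; apply/stabP; split=> // f.
rewrite mem_filter mem_iota => /andP[/orP[/hg //|/allP h] ltf].
by apply/eqP/h/candsP.
Qed.

Lemma iter_growP n F g : all (gtn N) F ->
  g \in stab F -> g \in stab (iter n (grow N rel P T) F).
Proof.
have ltgrow F' : all (gtn N) (grow N rel P T F').
  by apply/allP=> k; rewrite mem_filter mem_iota => /andP[].
move=> ltF gF; elim: n => //= n IH; apply: growP => //.
by case: n {IH} => [|n]; [exact: ltF | exact: ltgrow].
Qed.

Lemma stab_iota1 g : g \in stab (iota 0 N) -> g = 1.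
Proof.
move=> /stabP [gA hg]; apply: (pt_faithful act); first exact: (subsetP sAW).
by move=> k ltk; apply: hg; rewrite mem_iota.
Qed.

Lemma rigidP : rigid N rel P T -> A :=: 1.
Proof.
move=> /eqP r; apply/trivgP/subsetP=> g gA; rewrite inE; apply/eqP.
apply: stab_iota1; rewrite -r; apply: iter_growP => //.
by apply/stabP.
Qed.

(** The elements that send b to a given point form a coset of the stabiliser
    of b, or are absent. *)
Lemma card_stab_le (B : {group gT}) (b : nat) (D : seq nat) :
    B \subset W -> b < N -> (forall g, g \in B -> mv g b \in D) ->
  #|B| <= (size D * #|[set g in B | mv g b == b]|)%N.
Proof.
move=> sBW ltb hD.
have fibre x : #|[set g in B | mv g b == x]| <= #|[set g in B | mv g b == b]|.
  have [->|[h]] := set_0Vmem [set g in B | mv g b == x]; first by rewrite cards0.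
  rewrite inE => /andP[hB /eqP hx].
  rewrite -[leqRHS](card_rcoset _ h) subset_leq_card //.
  apply/subsetP=> g; rewrite inE => /andP[gB /eqP gx].
  rewrite mem_rcoset inE groupM ?groupV //=.
  by rewrite (pt_transport _ _ _ gx hx) ?(subsetP sBW).
suff main : #|[set g in B | mv g b \in D]| <=
    (size D * #|[set g in B | mv g b == b]|)%N.
  apply: leq_trans main; apply/subset_leq_card/subsetP=> g gB.
  by rewrite inE gB hD.
elim: D {hD} => [|x D IH] /=.
  by rewrite mul0n leqn0 cards_eq0; apply/eqP/setP=> g; rewrite !inE andbF.
rewrite mulSn; apply: leq_trans (leq_add (fibre x) IH).
apply: leq_trans (leq_card_setU _ _).1.
by apply/subset_leq_card/subsetP=> g; rewrite !inE -andb_orr.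
Qed.

End Stabilisers.

(** An element g of A that fixes F sends b to some candidate, an element h of H
    that fixes F does the same, and g h^-1 fixes b as well; by induction g h^-1
    is in H. The bound is the orbit-stabiliser theorem applied at each level. *)
Lemma siftP (A H : {group gT}) (T : seq (seq nat))
    (levels : seq (nat * seq (seq nat))) (F : seq nat) :
    A \subset W -> H \subset A ->
    (forall t, t \in T -> forall k, k < N -> code_at t k < N /\
       forall g, g \in A -> mv g (code_at t k) = code_at t (mv g k)) ->
    (forall l p, l \in levels -> p \in l.2 -> exists2 g, g \in H & codes p g) ->
    all (gtn N) F -> sift N rel T F levels ->
  stab A F \subset H
  /\ #|stab A F| <= \prod_(d <- sift_sizes N rel T F levels) d.
Proof.
move=> sAW sHA hT; have sHW := subset_trans sHA sAW.
elim: levels F => [|[b ps] levels IH] F hl ltF /=.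
  move=> /eqP r; suff -> : stab A F = 1 by rewrite sub1G cards1 big_nil.
  apply/eqP; rewrite eqEsubset; apply/andP; split; last first.
    by apply/subsetP=> g /set1P ->; apply: (group1 (Group (stab_group_set sAW ltF))).
  apply/subsetP=> g gF; rewrite inE; apply/eqP.
  by apply: (stab_iota1 sAW); rewrite -r; apply: (@iter_growP A T (fun _ _ => true) sAW hT _ 2).
case/and4P => ltb /allP hc /allP hps /IH{IH} IH.
set F' := F ++ _ in IH *.
have [||sH cH] := IH.
- by move=> l p ll; apply: hl; rewrite inE ll orbT.
- rewrite all_cat ltF /= ltb /=; apply/allP=> _ /mapP [t tT ->].
  by have [] := hT t tT b ltb.
have ltfF f : f \in F -> f < N by move/(allP ltF).
pose SF := Group (stab_group_set sAW ltF).
have sSFW : SF \subset W.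
  by apply/subsetP=> g /stabP [gA _]; apply: (subsetP sAW).
have stabF' g : g \in SF -> mv g b = b -> g \in stab A F'.
  move=> /stabP [gA hg] gb; apply/stabP; split=> // f.
  rewrite mem_cat inE => /or3P [/hg //|/eqP -> //|/mapP [t tT ->]].
  by have [_ ->] := hT t tT b ltb; rewrite ?gb.
have hcand g : g \in SF -> mv g b \in cands N rel (fun _ _ => true) T F b.
  by move=> gF; apply: (candsP sAW hT).
split.
  apply/subsetP=> g gF; have /stabP [gA _] := gF.
  have [||h] := reachP (K := (H :&: SF)%G) _ ltb _ (hc _ (hcand _ gF)).
  - by rewrite subIset // sHW.
  - move=> p pps; have [h hH ch] := hl _ _ (mem_head _ _) pps.
    exists h => //; rewrite inE hH; apply/stabP; split; first exact: (subsetP sHA).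
    by move=> f fF; rewrite ch ?ltfF //; apply/eqP/(allP (hps _ pps)).
  rewrite inE => /andP[hH hF] hb.
  have ghF : g * h^-1 \in stab A F'.
    apply: stabF'; first by rewrite groupM ?groupV.
    by apply: (pt_transport _ _ ltb erefl hb); [apply: (subsetP sAW) | apply: (subsetP sHW)].
  by rewrite -(groupMr _ (groupVr hH)) (subsetP sH).
rewrite big_cons; apply: leq_trans (card_stab_le sSFW ltb hcand) _.
rewrite leq_mul2l.
apply/orP; right; apply: leq_trans cH; apply/subset_leq_card/subsetP=> g.
by rewrite inE => /andP[gF /eqP]; apply: stabF'.
Qed.

End PointAction.

(** * The 27 lines *)

Local Open Scope ring_scope.

(** A weight is given by its values on the simple coroots. *)
Definition reflect_weight (i : nat) (c : seq int) : seq int :=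
  mkseq (fun j => c`_j - E6_coef j i * c`_i) 6.

(** The orbit of the first fundamental weight, in the order of a breadth-first
    search; the numbers of lines below refer to this order. *)
Definition E6_lines : seq (seq int) := Eval vm_compute in
  foldl (fun ls k => foldl (fun ls i =>
      let c := reflect_weight i (nth [::] ls k) in
      if c \in ls then ls else rcons ls c) ls (iota 0 6))
    [:: [:: 1; 0; 0; 0; 0; 0]] (iota 0 27).

Definition E6_gens : seq (seq nat) := Eval vm_compute in
  [seq [seq index (reflect_weight i c) E6_lines | c <- E6_lines] | i <- iota 0 6].

(** Three times the inverse of the Cartan matrix, that is, the Gram matrix of the
    fundamental weights up to the factor 3. *)
Definition E6_inverse_x3 : seq (seq int) :=
  [:: [:: 4; 3; 5; 6; 4; 2]; [:: 3; 6; 6; 9; 6; 3]; [:: 5; 6; 10; 12; 8; 4];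
      [:: 6; 9; 12; 18; 12; 6]; [:: 4; 6; 8; 12; 10; 5]; [:: 2; 3; 4; 6; 5; 4]].

(** Half of the square of the length of c - d: it is 0 for equal, 1 for skew and 2
    for meeting lines. *)
Definition half_square_distance (c d : seq int) : nat :=
  let x := mkseq (fun i => c`_i - d`_i) 6 in
  let q := foldr (fun i a => foldr (fun j b =>
    x`_i * (nth [::] E6_inverse_x3 i)`_j * x`_j + b) a (iota 0 6)) 0 (iota 0 6) in
  (absz q %/ 6)%N.

Definition E6_rel_table : seq (seq nat) := Eval vm_compute in
  [seq [seq half_square_distance c d | d <- E6_lines] | c <- E6_lines].

Definition E6_rel (i j : nat) : nat := nth 0%N (nth [::] E6_rel_table i) j.

(** The 27 weights span the weight lattice: each fundamental weight is written as
    an integral combination of at most three of them. *)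
Definition E6_weight_in_lines (j : nat) : seq (int * nat) :=
  nth [::] [:: [:: (1, 0%N)]; [:: (1, 0%N); (-1, 20%N)]; [:: (1, 0%N); (1, 1%N)];
               [:: (1, 0%N); (1, 1%N); (1, 2%N)]; [:: (-1, 25%N); (-1, 26%N)];
               [:: (-1, 26%N)]] j.

Lemma E6_lines_check :
  [&& uniq E6_lines, all (fun c => size c == 6)%N E6_lines,
      all (fun i => let p := nth [::] E6_gens i in
        all (fun k => [&& code_at p k < 27, code_at p (code_at p k) == k &
            nth [::] E6_lines (code_at p k) == reflect_weight i (nth [::] E6_lines k)]%N)
          (iota 0 27)
        && all (fun k => all (fun l =>
            E6_rel (code_at p k) (code_at p l) == E6_rel k l) (iota 0 27)) (iota 0 27))
        (iota 0 6)
    & all (fun j => all (fun ak => ak.2 < 27)%N (E6_weight_in_lines j) &&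
        all (fun i => foldr (fun ak b => ak.1 * (nth [::] E6_lines ak.2)`_i + b) 0
          (E6_weight_in_lines j) == (i == j)%:R) (iota 0 6)) (iota 0 6)].
Proof. by vm_compute. Qed.

Definition line_vec (k : nat) : 'cV[rat]_6 :=
  \col_j ((nth [::] E6_lines k)`_j)%:~R.

Lemma line_vec_inj k l : (k < 27)%N -> (l < 27)%N -> line_vec k = line_vec l -> k = l.
Proof.
have /and4P [un /allP sz _ _] := E6_lines_check.
move=> ltk ltl /colP e; apply/eqP; rewrite -(nth_uniq [::] _ _ un) //; apply/eqP.
have s6 i : (i < 27)%N -> size (nth [::] E6_lines i) = 6%N.
  by move=> lti; apply/eqP/sz/mem_nth.
apply: (@eq_from_nth _ 0); rewrite !s6 // => i lti.
by have := e (Ordinal lti); rewrite !mxE => /intr_inj.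
Qed.

(** A simple reflection acts on row vectors in root coordinates, hence on the
    left on columns of values on coroots. *)
Lemma simple_reflection_line (i : 'I_6) (k : nat) : (k < 27)%N ->
  simple_reflection E6 i *m line_vec k = line_vec (code_at (nth [::] E6_gens i) k).
Proof.
have /and4P [_ _ /allP h _] := E6_lines_check => ltk.
have := h i; rewrite mem_iota => /(_ (ltn_ord i))/andP[/allP/(_ k)].
rewrite mem_iota => /(_ ltk)/and3P[_ _ /eqP e] _.
apply/colP=> j; rewrite !mxE e nth_mkseq //.
under eq_bigr => l _ do rewrite !mxE mulrBl.
rewrite sumrB (bigD1 j) //= eqxx mul1r big1 ?addr0; last first.
  by move=> l /negPf nlj; rewrite eq_sym nlj mul0r.
rewrite rmorphB rmorphM /=; congr (_ - _).
rewrite (bigD1 i) //= eqxx mulr1 big1 ?addr0 // => l /negPf nli.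
by rewrite eq_sym nli mulr0 mul0r.
Qed.

Lemma line_vec_span (M : 'M[rat]_6) :
  (forall k, (k < 27)%N -> M *m line_vec k = line_vec k) -> M = 1%:M.
Proof.
move=> hM; have /and4P [_ _ _ /allP h] := E6_lines_check.
apply/matrixP=> r j; rewrite -[M]mulmx1.
have := h j; rewrite mem_iota => /(_ (ltn_ord j))/andP[/allP lt27 /allP e].
have ej : delta_mx j 0 = \sum_(ak <- E6_weight_in_lines j) ak.1%:~R *: line_vec ak.2.
  apply/colP=> i; rewrite mxE eqxx andbT summxE.
  have := e i; rewrite mem_iota => /(_ (ltn_ord i))/eqP ei.
  transitivity ((i == j)%:R%:~R : rat); first by case: (i == j).
  rewrite -[i == j]/((i : nat) == j) -ei; elim: (E6_weight_in_lines j) => [|ak l IH] /=.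
    by rewrite big_nil.
  by rewrite big_cons rmorphD rmorphM /= IH !mxE.
have : M *m delta_mx j 0 = delta_mx j 0 :> 'cV_6.
  rewrite ej mulmx_sumr; apply: eq_big_seq => ak /lt27 lak.
  by rewrite -scalemxAr hM.
by rewrite -colE mulmx1 => /colP/(_ r); rewrite !mxE eqxx andbT.
Qed.

(** The line k is sent by g to the line with vector g^-1 v_k; the inverse turns the
    left action on columns into a right action. Stability of the set of lines and
    invariance of the relation hold for generators by inspection. Since the lines
    span, an element that fixes them all acts as the identity matrix. *)
Lemma weyl_group_E6_lines (gT : finGroupType) (W : {group gT}) :
    weyl_group E6 W ->
  exists (mv : gT -> nat -> nat) (gs : seq gT),
    [/\ point_action 27 E6_rel W mv, size gs = 6%N, <<[set:: gs]>>%g = W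
      & forall i, (i < 6)%N -> codes 27 mv (nth [::] E6_gens i) (nth 1%g gs i)].
Proof.
move=> [rW [faith [s [genW rs]]]].
pose mv g k := if [pick l : 'I_27 | rW g^-1%g *m line_vec k == line_vec l] is Some l
               then nat_of_ord l else 0%N.
pose G0 := [set g in W | [forall k : 'I_27, exists l : 'I_27,
  rW g^-1%g *m line_vec k == line_vec l]].
have sWi i : s i \in W by rewrite -genW mem_gen // imset_f.
have G0P g : g \in G0 -> g \in W /\ forall k, (k < 27)%N ->
    exists2 l, (l < 27)%N & rW g^-1%g *m line_vec k = line_vec l.
  rewrite inE => /andP[gW /forallP h]; split=> // k ltk.
  by have /existsP [l /eqP e] := h (Ordinal ltk); exists l.
have G0grp : group_set G0.
  apply/group_setP; split.
    rewrite inE group1; apply/forallP=> k; apply/existsP; exists k.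
    by rewrite invg1 repr_mx1 mul1mx.
  move=> g h /G0P [gW hg] /G0P [hW hh]; rewrite inE groupM //=.
  apply/forallP=> k; have [l ltl el] := hg k (ltn_ord k).
  have [m ltm em] := hh l ltl; apply/existsP; exists (Ordinal ltm).
  by rewrite invMg repr_mxM ?groupV // -mulmxA el em.
have /and4P [_ _ /allP htab _] := E6_lines_check.
have tab i : (i < 6)%N -> (forall k, (k < 27)%N -> (code_at (nth [::] E6_gens i) k < 27)%N /\
      code_at (nth [::] E6_gens i) (code_at (nth [::] E6_gens i) k) = k)
    /\ (forall k l, (k < 27)%N -> (l < 27)%N -> E6_rel (code_at (nth [::] E6_gens i) k)
       (code_at (nth [::] E6_gens i) l) = E6_rel k l).
  move=> lti; have := htab i; rewrite mem_iota => /(_ lti)/andP[/allP h1 /allP h2].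
  split=> [k ltk|k l ltk ltl].
    by have := h1 k; rewrite mem_iota => /(_ ltk)/and3P[? /eqP].
  have := h2 k; rewrite mem_iota => /(_ ltk)/allP/(_ l).
  by rewrite mem_iota => /(_ ltl)/eqP.
have sline (i : 'I_6) k : (k < 27)%N ->
    rW (s i)^-1%g *m line_vec k = line_vec (code_at (nth [::] E6_gens i) k).
  move=> ltk; have [lta aK] := (tab i (ltn_ord i)).1 k ltk.
  rewrite -{1}aK -simple_reflection_line // -rs mulmxA.
  by rewrite -repr_mxM ?groupV // mulVg repr_mx1 mul1mx.
have sWG0 : W \subset Group G0grp.
  rewrite -{1}genW gen_subG; apply/subsetP=> _ /imsetP [i _ ->].
  rewrite inE sWi; apply/forallP=> k.
  have [lta _] := (tab i (ltn_ord i)).1 k (ltn_ord k).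
  by apply/existsP; exists (Ordinal lta); rewrite sline.
have mvP g k : g \in W -> (k < 27)%N ->
    (mv g k < 27)%N /\ rW g^-1%g *m line_vec k = line_vec (mv g k).
  move=> gW ltk; have [_ /(_ k ltk)[l ltl el]] := G0P g (subsetP sWG0 g gW).
  rewrite /mv; case: pickP => [m /eqP em|/(_ (Ordinal ltl))]; first by split.
  by rewrite el eqxx.
have mvE g k l : g \in W -> (k < 27)%N -> (l < 27)%N ->
    rW g^-1%g *m line_vec k = line_vec l -> mv g k = l.
  move=> gW ltk ltl; have [ltg ->] := mvP g k gW ltk.
  exact: line_vec_inj.
have mv1 k : (k < 27)%N -> mv 1%g k = k.
  by move=> ltk; apply: mvE; rewrite // invg1 repr_mx1 mul1mx.
have mvM g h k : g \in W -> h \in W -> (k < 27)%N -> mv (g * h)%g k = mv h (mv g k).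
  move=> gW hW ltk; have [ltg eg] := mvP g k gW ltk.
  have [lth eh] := mvP h _ hW ltg; apply: mvE; rewrite ?groupM //.
  by rewrite invMg repr_mxM ?groupV // -mulmxA eg eh.
have mvs (i : 'I_6) k : (k < 27)%N -> mv (s i) k = code_at (nth [::] E6_gens i) k.
  move=> ltk; have [lta _] := (tab i (ltn_ord i)).1 k ltk.
  by apply: mvE => //; apply: sline.
exists mv, [seq s i | i <- enum 'I_6]; split.
- split=> // [g k gW ltk|g i j gW lti ltj|g gW hg].
  + exact: (mvP g k gW ltk).1.
  + pose G1 := [set g in W | [forall k : 'I_27, forall l : 'I_27,
      E6_rel (mv g k) (mv g l) == E6_rel k l]].
    have G1P h : h \in G1 -> h \in W /\ forall k l, (k < 27)%N -> (l < 27)%N ->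
        E6_rel (mv h k) (mv h l) = E6_rel k l.
      rewrite inE => /andP[hW /forallP hh]; split=> // k l ltk ltl.
      by have /forallP/(_ (Ordinal ltl))/eqP := hh (Ordinal ltk).
    have G1grp : group_set G1.
      apply/group_setP; split.
        rewrite inE group1; apply/forallP=> k; apply/forallP=> l.
        by rewrite !mv1.
      move=> a b /G1P [aW ha] /G1P [bW hb]; rewrite inE groupM //=.
      apply/forallP=> k; apply/forallP=> l; rewrite !mvM // hb ?ha //.
      * exact: (mvP a k aW _).1.
      * exact: (mvP a l aW _).1.
    have sWG1 : W \subset Group G1grp.
      rewrite -{1}genW gen_subG; apply/subsetP=> _ /imsetP [r _ ->].
      rewrite inE sWi; apply/forallP=> k; apply/forallP=> l.
      by rewrite !mvs // (tab r _).2.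
    by have [_ ->] := G1P g (subsetP sWG1 g gW).
  + have : g^-1%g \in rker rW.
      rewrite inE groupV gW mul1mx; apply/eqP/line_vec_span => k ltk.
      by rewrite (mvP g k gW ltk).2 hg.
    by move=> /(subsetP faith)/set1P/(congr1 (@invg gT)); rewrite invgK invg1.
- by rewrite size_map size_enum_ord.
- rewrite -genW; congr <<_>>%g; apply/setP=> g; rewrite inE.
  by apply/mapP/imsetP => [[i _ ->]|[i _ ->]]; exists i; rewrite ?mem_enum.
move=> i lti k ltk; rewrite (nth_map (Ordinal lti)) ?size_enum_ord //.
by rewrite mvs // nth_enum_ord.
Qed.

(** * Reflection groups on functions on the points *)

(** The pair (a, b) stands for a + b t, where t^2 = - 1 - q t: thus t = i for
    q = 0, and t is a primitive cube root of unity for q = 1. *)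
Definition coef : Type := int * int.

Definition csub (x y : coef) : coef := (x.1 - y.1, x.2 - y.2).
Definition cadd (x y : coef) : coef := (x.1 + y.1, x.2 + y.2).
Definition cmul (q : int) (x y : coef) : coef :=
  (x.1 * y.1 - x.2 * y.2, x.1 * y.2 + x.2 * y.1 - q * (x.2 * y.2)).
Definition cdot (q : int) (xs ys : seq coef) : coef :=
  foldr (fun xy a => cadd (cmul q xy.1 xy.2) a) (0, 0) (zip xs ys).
(** The product of x with its conjugate a + b t', t' = - q - t. *)
Definition cnorm (q : int) (x : coef) : int :=
  x.1 * x.1 - q * (x.1 * x.2) + x.2 * x.2.

Definition czero (p : nat) (x : coef) : bool :=
  (p %| absz x.1)%N && (p %| absz x.2)%N.
(** If a + b t vanishes then so does its norm, which is an integer. *)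
Definition cnonzero (p : nat) (q : int) (x : coef) : bool :=
  ~~ (p %| absz (cnorm q x))%N.

Definition coef_field (p : nat) (q : int) (F : fieldType) (t : F) : Prop :=
  t * t = - 1 - q%:~R * t /\
  forall z : int, (z%:~R == 0 :> F) = (p %| absz z)%N.

Definition entry (f : seq coef) (k : nat) : coef := nth (0, 0) f k.

(** Each row has a point where it does not vanish and all later rows do. *)
Fixpoint echelon (N p : nat) (q : int) (rows : seq (seq coef)) : bool :=
  if rows is f :: fs then
    has (fun k => cnonzero p q (entry f k) && all (fun h => czero p (entry h k)) fs)
      (iota 0 N)
    && echelon N p q fs
  else true.

(** Expresses f_i (k) = f_i (g k) + c_i * sum_j r_j f_j (g k) for all rows f_i,
    that is, L g = (1 + c r) L, at the points g k. *)
Definition reflects (N p : nat) (q : int) (rows : seq (seq coef))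
    (g : seq nat) (c r : seq coef) : bool :=
  [&& has (cnonzero p q) c, has (cnonzero p q) r,
      (size c == size rows)%N, (size r == size rows)%N &
      all (fun k =>
        let gk := code_at g k in
        let s := cdot q r [seq entry f gk | f <- rows] in
        all (fun fc => czero p (csub (entry fc.1 k)
            (cadd (entry fc.1 gk) (cmul q fc.2 s)))) (zip rows c))
        (iota 0 N)].

(** A necessary condition for f (k) = f (x) for all rows f; a nonzero difference
    whose norm is divisible by p passes it. *)
Definition same_values (p : nat) (q : int) (rows : seq (seq coef)) (k x : nat) :
    bool :=
  all (fun f => ~~ cnonzero p q (csub (entry f k) (entry f x))) rows.

Section CoefField.
Variables (p : nat) (q : int) (F : fieldType) (t : F).
Hypothesis hF : coef_field p q t.

Definition cval (x : coef) : F := x.1%:~R + x.2%:~R * t.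

Lemma cvalB x y : cval (csub x y) = cval x - cval y.
Proof. by rewrite /cval /csub !rmorphB /=; ring. Qed.

Lemma cvalD x y : cval (cadd x y) = cval x + cval y.
Proof. by rewrite /cval /cadd !rmorphD /=; ring. Qed.

Lemma cvalM x y : cval (cmul q x y) = cval x * cval y.
Proof.
have [tt _] := hF; rewrite /cval /cmul /= !(rmorphB, rmorphD, rmorphM) /=.
transitivity (x.1%:~R * y.1%:~R + (x.1%:~R * y.2%:~R + x.2%:~R * y.1%:~R) * t
  + x.2%:~R * y.2%:~R * (- 1 - q%:~R * t)); first by ring.
by rewrite -tt; ring.
Qed.

Lemma czeroP x : czero p x -> cval x = 0.
Proof.
have [_ h] := hF; rewrite /czero -!h /cval => /andP[/eqP-> /eqP->].
by rewrite mul0r addr0.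
Qed.

Lemma cnonzeroP x : cnonzero p q x -> cval x != 0.
Proof.
have [tt h] := hF; rewrite /cnonzero -h; apply: contraNneq => x0; apply/eqP.
transitivity (cval x * (x.1%:~R - q%:~R * x.2%:~R - x.2%:~R * t)); last first.
  by rewrite x0 mul0r.
rewrite /cval /cnorm !(rmorphB, rmorphD, rmorphM) /=.
transitivity (x.1%:~R * x.1%:~R - q%:~R * (x.1%:~R * x.2%:~R)
  - q%:~R * x.2%:~R * x.2%:~R * t - x.2%:~R * x.2%:~R * (- 1 - q%:~R * t));
  first by ring.
by rewrite -tt; ring.
Qed.

Lemma cval_dot xs ys : size xs = size ys ->
  cval (cdot q xs ys) = \sum_(i < size xs) cval (entry xs i) * cval (entry ys i).
Proof.
elim: xs ys => [|x xs IH] [|y ys] //= => [_|[/IH {}IH]].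
  by rewrite big_ord0 /cval mul0r addr0.
by rewrite big_ord_recl /cdot /= cvalD cvalM IH.
Qed.

Definition rows_mx (N : nat) (rows : seq (seq coef)) : 'M[F]_(size rows, N) :=
  \matrix_(i, k) cval (entry (nth [::] rows i) k).

Lemma echelon_row_free N rows : echelon N p q rows -> row_free (rows_mx N rows).
Proof.
move=> ech; apply: inj_row_free => v vL.
suff main (a : nat -> F) : (forall k, (k < N)%N ->
      \sum_(i < size rows) a i * cval (entry (nth [::] rows i) k) = 0) ->
    forall i, (i < size rows)%N -> a i = 0.
  pose a i := if insub i is Some j then v 0 j else 0.
  have av (j : 'I_(size rows)) : a j = v 0 j by rewrite /a valK.
  apply/rowP=> i; rewrite mxE -av; apply: main => // k ltk.
  have /rowP/(_ (Ordinal ltk)) := vL; rewrite !mxE => e; rewrite -[RHS]e.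
  by apply: eq_bigr => j _; rewrite av mxE.
elim: rows a ech {v vL} => [|f fs IH] a //= /andP[/hasP [k]].
rewrite mem_iota /= => ltk /andP[nz /allP z] ech h.
have a0 : a 0%N = 0.
  have := h k ltk; rewrite big_ord_recl /= big1 => [|i _]; last first.
    by rewrite (czeroP (z _ (mem_nth _ (ltn_ord i)))) mulr0.
  by move/eqP; rewrite addr0 mulf_eq0 (negPf (cnonzeroP nz)) orbF => /eqP.
move=> [//|i lti]; apply: (IH (fun i => a i.+1)) => // l ltl.
by have := h l ltl; rewrite big_ord_recl /= a0 mul0r add0r.
Qed.

End CoefField.

Section LineModule.
Variables (N : nat) (rel : nat -> nat -> nat) (gT : finGroupType).
Variables (W : {group gT}) (mv : gT -> nat -> nat) (F : fieldType).
Hypothesis act : point_action N rel W mv.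

(** The matrix of g on functions: (f g) (l) = f (g^-1 l). *)
Definition point_mx (g : gT) : 'M[F]_N := \matrix_(k, l) ((k : nat) == mv g^-1%g l)%:R.

Lemma mul_point_mx m (L : 'M[F]_(m, N)) g i (k l : 'I_N) : g \in W ->
  mv g k = l -> (L *m point_mx g) i l = L i k.
Proof.
move=> gW gk; have e : mv g^-1%g l = k.
  by rewrite -gk -(ptM act) ?groupV // mulgV (pt1 act).
rewrite mxE (bigD1 k) //= mxE e eqxx mulr1 big1 ?addr0 // => m' nm.
by rewrite mxE e val_eqE (negPf nm) mulr0.
Qed.

Lemma point_mx_repr : mx_repr W point_mx.
Proof.
split=> [|g h gW hW].
  apply/matrixP=> k l; rewrite !mxE invg1 (pt1 act) // val_eqE.
apply/matrixP=> k l; have ltl := pt_lt act (groupVr hW) (ltn_ord l).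
rewrite (@mul_point_mx _ _ h k (Ordinal ltl) l hW); last first.
  by rewrite /= -(ptM act) ?groupV // mulVg (pt1 act).
by rewrite !mxE invMg (ptM act) ?groupV.
Qed.

Definition point_repr := MxRepresentation point_mx_repr.

End LineModule.

Section LineReflections.
Variables (N : nat) (rel : nat -> nat -> nat) (gT : finGroupType).
Variables (W : {group gT}) (mv : gT -> nat -> nat).
Hypothesis act : point_action N rel W mv.
Variables (p : nat) (q : int) (F : fieldType) (t : F).
Hypothesis hF : coef_field p q t.

Lemma nonzero_entry (c : seq coef) : has (cnonzero p q) c ->
  exists i : 'I_(size c), cval t (entry c i) != 0.
Proof.
case/(has_nthP (0, 0)) => i lti nz; exists (Ordinal lti).
exact: (cnonzeroP hF).
Qed.

Lemma reflectsP (rows : seq (seq coef)) (g : seq nat) (c r : seq coef) (x : gT) :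
    x \in W -> codes N mv g x -> reflects N p q rows g c r ->
  exists (cc : 'cV[F]_(size rows)) (rr : 'rV[F]_(size rows)),
    [/\ cc != 0, rr != 0
      & rows_mx t N rows *m point_mx N mv F x
        = (1%:M + cc *m rr) *m rows_mx t N rows].
Proof.
move=> xW cx /and5P [/nonzero_entry [i0 ci] /nonzero_entry [j0 rj] /eqP sc /eqP sr /allP h].
exists (\col_i cval t (entry c i)), (\row_j cval t (entry r j)); split.
- apply: contraNneq ci => /colP/(_ (cast_ord sc i0)); rewrite !mxE => /eqP.
  by [].
- by apply: contraNneq rj => /rowP/(_ (cast_ord sr j0)); rewrite !mxE => /eqP.
apply/matrixP=> i l.
have ltk := pt_lt act (groupVr xW) (ltn_ord l).
have xk : mv x (Ordinal ltk) = l.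
  by rewrite /= -(ptM act) ?groupV // mulVg (pt1 act).
rewrite (mul_point_mx act _ _ xW xk) mulmxDl mul1mx -mulmxA !mxE big_ord1 !mxE.
have := h (Ordinal ltk); rewrite mem_iota ltk => /(_ isT)/allP.
rewrite -(cx _ ltk) xk => /(_ (nth [::] rows i, entry c i)).
have -> : (nth [::] rows i, entry c i) \in zip rows c.
  by rewrite -nth_zip ?sc // mem_nth // size_zip sc minnn.
move=> /(_ isT) /(czeroP hF); rewrite cvalB cvalD (cvalM hF) /= => /eqP.
rewrite subr_eq0 => /eqP ->; congr (_ + _ * _).
rewrite (cval_dot hF) ?size_map // sr; apply: eq_bigr => j _.
by rewrite !mxE {2}/entry (nth_map [::]).
Qed.

(** Faithfulness: an element of the group that fixes all rows of L sends each
    point k to a point in the orbit of k on which the rows have the same values,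
    and it commutes with T; the rigidity check leaves k alone. *)
Lemma line_reflection_group (gs : seq gT) (rows : seq (seq coef))
    (refl : seq (seq nat * seq coef * seq coef)) (orbs T : seq (seq nat)) :
    {subset gs <= W} -> size refl = size gs ->
    (forall i, (i < size gs)%N ->
       codes N mv (nth ([::], [::], [::]) refl i).1.1 (nth 1%g gs i)) ->
    echelon N p q rows ->
    all (fun x => reflects N p q rows x.1.1 x.1.2 x.2) refl ->
    orbits_closed N [seq x.1.1 | x <- refl] orbs ->
    (forall s, s \in T -> exists2 h, h \in W & codes N mv s h /\
       (forall g, g \in gs -> commute g h)) ->
    rigid N rel (fun k x => (x \in nth [::] orbs k) && same_values p q rows k x) T ->
  reflection_group_over F <<[set:: gs]>>%G.
Proof.
move=> sgW sz hc ech /allP href horb hT hr.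
have genW : <<[set:: gs]>> \subset W.
  by rewrite gen_subG; apply/subsetP=> g; rewrite inE => /sgW.
pose L := rows_mx t N rows.
have memi g : g \in gs -> exists2 x, x \in refl & codes N mv x.1.1 g.
  move=> /(nthP 1%g) [i lti <-]; exists (nth ([::], [::], [::]) refl i).
    by rewrite mem_nth ?sz.
  exact: hc.
apply: (@submodule_reflection_group _ _ W _ _ _ (point_repr F act) L [set:: gs]) => //.
- exact: (echelon_row_free hF).
- move=> g; rewrite inE => ggs; have [x xr cx] := memi g ggs.
  by apply: (reflectsP _ cx (href _ xr)); apply: sgW.
pose A := [set g in <<[set:: gs]>> | L *m point_repr F act g == L].
have gA : group_set A.
  apply/group_setP; split; first by rewrite inE group1 repr_mx1 mulmx1 eqxx.
  move=> a b; rewrite !inE => /andP[Ha /eqP ea] /andP[Hb /eqP eb].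
  by rewrite groupM // repr_mxM ?(subsetP genW) // mulmxA ea eb eqxx.
have sAW : Group gA \subset W.
  by apply/subsetP=> g; rewrite inE => /andP[/(subsetP genW)].
have A1 : Group gA :=: 1%g.
  apply: (rigidP act sAW _ _ hr) => [s sT k ltk|g k gAg ltk].
    have [h hW [ch cm]] := hT s sT; rewrite -ch //; split; first exact: (pt_lt act).
    move=> g gAg; have gW := subsetP sAW g gAg.
    rewrite -ch ?(pt_lt act) // -!(ptM act) //; congr (mv _ k).
    move: gAg; rewrite inE => /andP[gH _].
    have : h \in 'C(<<[set:: gs]>>)%g.
      rewrite cent_gen; apply/centP=> y; rewrite inE => yg.
      by apply/commute_sym/cm.
    by move/centP; apply.
  have gW := subsetP sAW g gAg; have ltg := pt_lt act gW ltk.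
  move: gAg; rewrite inE => /andP[gH /eqP eL]; apply/andP; split.
    apply: (orbits_closedP act sgW _ horb) => // x /memi [y yr cy].
    by exists y.1.1 => //; apply: map_f.
  apply/allP=> f /(nthP [::]) [i lti <-]; apply/negP=> /(cnonzeroP hF).
  have := mul_point_mx act L (Ordinal lti) (k := Ordinal ltk) (l := Ordinal ltg) gW erefl.
  by rewrite [L *m _]eL !mxE cvalB => <-; rewrite subrr eqxx.
move=> g gH eg; have : g \in Group gA by rewrite inE gH eg eqxx.
by rewrite A1 => /set1P.
Qed.

End LineReflections.

(** * Certificates for centralisers *)

(** A direct factor: a cyclic group, or the group generated by some words, given
    with characteristic p, the q of the coefficients, rows spanning a submodule,
    and for each word the c and r of [reflects]. *)
Inductive factor :=
  | Cyclic of seq nat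
  | Reflections of nat & int & seq (seq coef)
      & seq (seq nat * seq coef * seq coef).

Definition factor_words (f : factor) : seq (seq nat) :=
  match f with
  | Cyclic u => [:: u]
  | Reflections _ _ _ gens => [seq x.1.1 | x <- gens]
  end.

Definition word_code : seq nat -> seq nat := compose 27 E6_gens.

Definition factor_codes (f : factor) : seq (seq nat) :=
  [seq word_code u | u <- factor_words f].

Definition code_orbits (cs : seq (seq nat)) : seq (seq nat) :=
  [seq code_orbit 27 cs k | k <- iota 0 27].

(** No element of the Weyl group of type E_6 has order greater than 12. *)
Definition code_powers (c : seq nat) : seq (seq nat) :=
  traject (fun p => [seq code_at c k | k <- p]) (iota 0 27) 12.

(** The rigidity check may use commutation with the powers of w and with the
    generators of the other factors. For p = 3 the choice q = 1 admits t = 1. *)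
Definition factor_check (wc : seq nat) (all_codes : seq (seq nat)) (f : factor) :
    bool :=
  match f with
  | Cyclic _ => true
  | Reflections p q rows gens =>
    let cs := factor_codes f in
    let orbs := code_orbits cs in
    [&& (p == 0%N) || (p == 3%N) && (q == 1),
        echelon 27 p q rows,
        all (fun x => reflects 27 p q rows (word_code x.1.1) x.1.2 x.2) gens,
        orbits_closed 27 cs orbs &
        rigid 27 E6_rel
          (fun k x => (x \in nth [::] orbs k) && same_values p q rows k x)
          (code_powers wc ++
           [seq d <- all_codes | all (code_commute 27 d) cs])]
  end.

(** Each factor meets the product of the later ones trivially: a common element
    commutes with all generators and stays in the orbits of both groups. *)
Fixpoint independent (fs : seq factor) : bool :=
  if fs is f :: fs' then
    let cs := factor_codes f in
    let ds := flatten (map factor_codes fs') in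
    let orbs1 := code_orbits cs in
    let orbs2 := code_orbits ds in
    [&& all (fun c => all (code_commute 27 c) ds) cs,
        orbits_closed 27 cs orbs1, orbits_closed 27 ds orbs2,
        rigid 27 E6_rel
          (fun k x => (x \in nth [::] orbs1 k) && (x \in nth [::] orbs2 k))
          (cs ++ ds)
      & independent fs']
  else true.

(** The element w, the levels of the sifting, whose permutations are words in the
    generators of the factors, and the factors. *)
Record certificate := Certificate {
  cert_word : seq nat;
  cert_levels : seq (nat * seq (seq nat));
  cert_factors : seq factor
}.

Definition cert_code (ct : certificate) : seq nat := word_code (cert_word ct).

Definition cert_gen_codes (ct : certificate) : seq (seq nat) :=
  flatten (map factor_codes (cert_factors ct)).

Definition cert_sift_levels (ct : certificate) : seq (nat * seq (seq nat)) :=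
  [seq (l.1, [seq compose 27 (cert_gen_codes ct) u | u <- l.2])
     | l <- cert_levels ct].

(** Binary numbers, because the bound for w = 1 is the order of W. *)
Definition cert_bound (ct : certificate) : N :=
  foldr (fun d b => N.mul (N.of_nat d) b) 1%num
    (sift_sizes 27 E6_rel (code_powers (cert_code ct)) [::] (cert_sift_levels ct)).

Definition cert_check (ct : certificate) : bool :=
  let wc := cert_code ct in
  let all_codes := cert_gen_codes ct in
  [&& all (code_commute 27 wc) all_codes, independent (cert_factors ct),
      all (factor_check wc all_codes) (cert_factors ct)
    & sift 27 E6_rel (code_powers wc) [::] (cert_sift_levels ct)].

(** The number of fixed lines and the number of lines that are skew to their
    image. *)
Definition displacement (c : seq nat) : nat * nat :=
  (count (fun k => E6_rel k (code_at c k) == 0%N) (iota 0 27),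
   count (fun k => E6_rel k (code_at c k) == 1%N) (iota 0 27)).

Definition cert_invariant (ct : certificate) : seq (nat * nat) :=
  [seq displacement (nth [::] (code_powers (cert_code ct)) a) | a <- [:: 1; 2; 3]%N].

(** The divisions of n by the bounds c are exact, so the last condition says that
    sum 1 / c = 1. *)
Definition class_table_check (n : N) (cts : seq certificate) : bool :=
    [&& all cert_check cts, uniq [seq cert_invariant ct | ct <- cts],
      all (fun ct => N.mul (cert_bound ct) (N.div n (cert_bound ct)) == n) cts &
      foldr (fun ct a => N.add (N.div n (cert_bound ct)) a) 0%num cts == n].

(** Complex coefficients serve for real reflections too. *)
Lemma complex_coef_field (R : rcfType) (q : int) :
  exists t : R[i], coef_field 0 q t.
Proof.
pose a i : R[i] := if i == 0%N then -1 else - q%:~R.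
have [t ht] := @solve_monicpoly R[i] 2 a isT.
exists t; split.
  by rewrite -expr2 ht !big_ord_recl big_ord0 /= expr0 expr1 addr0 mulr1 mulNr.
by move=> z; rewrite intr_eq0 dvd0n absz_eq0.
Qed.

(** Modulo 3, 1 is a root of t^2 + t + 1. *)
Lemma F3_coef_field : coef_field 3 1 (1 : 'F_3).
Proof.
split=> [|z]; first exact/eqP.
by rewrite -(dvdz_pcharf (pchar_Fp _)).
Qed.

Section Soundness.
Variables (R : realType) (gT : finGroupType) (W : {group gT}).
Variables (mv : gT -> nat -> nat) (gs : seq gT).
Hypothesis act : point_action 27 E6_rel W mv.
Hypothesis size_gs : size gs = 6%N.
Hypothesis gen_gs : <<[set:: gs]>>%g = W.
Hypothesis codes_gs :
  forall i, (i < 6)%N -> codes 27 mv (nth [::] E6_gens i) (nth 1%g gs i).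

Lemma word_in u : gprod gs u \in W.
Proof. by rewrite -gen_gs gprod_gen. Qed.

Lemma word_codes u : codes 27 mv (word_code u) (gprod gs u).
Proof.
apply: (codes_compose act); rewrite ?size_gs //.
by move=> g ggs; rewrite -gen_gs mem_gen // inE.
Qed.

Definition factor_elts (f : factor) : seq gT :=
  [seq gprod gs u | u <- factor_words f].

Definition factor_group (f : factor) : {group gT} := <<[set:: factor_elts f]>>%G.

Lemma factor_elts_in f : {subset factor_elts f <= W}.
Proof. by move=> g /mapP [u _ ->]; apply: word_in. Qed.

Lemma flatten_factor (fs : seq factor) (P : seq nat -> gT -> Prop) :
    (forall u, P (word_code u) (gprod gs u)) ->
  (forall c, c \in flatten (map factor_codes fs) ->
     exists2 g, g \in flatten (map factor_elts fs) & P c g) /\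
  (forall g, g \in flatten (map factor_elts fs) ->
     exists2 c, c \in flatten (map factor_codes fs) & P c g).
Proof.
move=> hP; elim: fs => [|f fs [IH1 IH2]] //=; split=> x; rewrite mem_cat.
  case/orP => [/mapP [u uf ->]|/IH1 [g gg Pg]].
    by exists (gprod gs u); rewrite ?mem_cat ?map_f.
  by exists g; rewrite // mem_cat gg orbT.
case/orP => [/mapP [u uf ->]|/IH2 [c cc Pc]].
  by exists (word_code u); rewrite ?mem_cat ?map_f.
by exists c; rewrite // mem_cat cc orbT.
Qed.

Lemma iter_codes u i :
  codes 27 mv (iter i (fun p => [seq code_at (word_code u) k | k <- p]) (iota 0 27))
    (gprod gs u ^+ i)%g.
Proof.
elim: i => [|i IH] k ltk.
  by rewrite expg0 (pt1 act) // /code_at [RHS](_ : _ = nth 0%N (iota 0 27) k) ?nth_iota.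
have gX j := groupX j (word_in u).
rewrite iterS expgSr (ptM act) ?word_in // IH // /code_at (nth_map 0%N); last first.
  by case: i {IH} => [|i]; rewrite ?size_iota //= size_map; elim: i => //= i;
     rewrite size_map.
by rewrite -/(code_at _ _) -IH // word_codes ?(pt_lt act).
Qed.

Lemma powers_codes u s : s \in code_powers (word_code u) ->
  exists i, codes 27 mv s (gprod gs u ^+ i)%g.
Proof. by case/trajectP => i _ ->; exists i; apply: iter_codes. Qed.

Lemma factor_checkP u (allc : seq (seq nat)) f :
    (forall c, c \in allc -> exists2 h, h \in W & codes 27 mv c h) ->
    (forall g, g \in factor_elts f -> commute g (gprod gs u)) ->
    factor_check (word_code u) allc f ->
  reflection_group R (factor_group f).
Proof.
case: f => [v|p q rows gens] hall hcomm.
  move=> _; constructor 2; rewrite /factor_group /=.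
  have -> : <<[set:: factor_elts (Cyclic v)]>>%G = <[gprod gs v]>%G.
    apply/val_inj; congr <<_>>%g; apply/setP=> g.
    by rewrite !inE.
  by apply: cyclic_reflection_group; rewrite pnatr_eq0 -lt0n order_gt0.
case/and5P => hp ech hrefl horb hrig.
pose refl := [seq (word_code x.1.1, x.1.2, x.2) | x <- gens].
have main (F : fieldType) (t : F) : coef_field p q t ->
    reflection_group_over F (factor_group (Reflections p q rows gens)).
  move=> hF.
  apply: (line_reflection_group act hF (rows := rows) (refl := refl)
    (orbs := code_orbits (factor_codes (Reflections p q rows gens))) _ _ _ ech _ _ _ hrig).
  - exact: factor_elts_in.
  - by rewrite !size_map.
  - move=> i; rewrite !size_map => lti.
    rewrite /refl (nth_map ([::], [::], [::])) //= /factor_elts /= (nth_map [::]) ?size_map //.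
    rewrite (nth_map ([::], [::], [::])) //; exact: word_codes.
  - by rewrite all_map; apply: sub_all hrefl.
  - by move: horb; rewrite /factor_codes /= -!map_comp.
  move=> s; rewrite mem_cat => /orP [/powers_codes [i ci]|].
    exists (gprod gs u ^+ i)%g; first by rewrite groupX ?word_in.
    by split=> // g /hcomm/commuteX.
  rewrite mem_filter => /andP[/allP hs /hall [h hW ch]].
  exists h => //; split=> // g /mapP [v vf ->].
  apply/commute_sym/(codes_commute act hW (word_in v) ch (word_codes v)).
  by apply: hs; apply: map_f.
case/orP: hp => [/eqP p0|/andP [/eqP p3 /eqP q1]].
  have [t ht] := complex_coef_field R q.
  by constructor 2; apply: (main _ t); rewrite p0.
by constructor 3; apply: (main _ 1); rewrite p3 q1; apply: F3_coef_field.
Qed.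

Lemma independentP fs : independent fs ->
  (\big[dprod/1]_(H <- map factor_group fs) (H : {set gT}))%g
    = <<[set:: flatten (map factor_elts fs)]>>%g.
Proof.
elim: fs => [_|f fs IH] /=.
  by rewrite big_nil; apply/esym/trivgP; rewrite gen_subG; apply/subsetP=> g;
     rewrite !inE.
case/and5P => /allP hc ho1 ho2 hr /IH {}IH.
rewrite big_cons IH /=.
set ds := flatten (map factor_codes fs) in hc ho2 hr *.
set K := <<[set:: flatten (map factor_elts fs)]>>%G.
have [d1 d2] := @flatten_factor fs (fun c g => codes 27 mv c g /\ g \in W)
  (fun u => conj (word_codes u) (word_in u)).
have eltsW : {subset flatten (map factor_elts fs) <= W}.
  by move=> g /d2 [c _ []].
have KW : K \subset W.
  by rewrite gen_subG; apply/subsetP=> g; rewrite inE => /eltsW.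
have cent : K \subset 'C(factor_group f)%g.
  rewrite /= cent_gen gen_subG; apply/subsetP=> g; rewrite inE => gg.
  apply/centP=> h; rewrite inE => /mapP [u uf ->].
  have [d dd [cd gW]] := d2 g gg.
  apply/commute_sym/(codes_commute act (word_in u) gW (word_codes u) cd).
  by have /allP := hc _ (map_f word_code uf); apply.
have ti : (factor_group f :&: K)%G :=: 1%g.
  apply: (rigidP act _ _ _ hr); first by rewrite subIset // KW orbT.
    move=> s sT k ltk.
    have [h [hW ch hH]] : exists h, [/\ h \in W, codes 27 mv s h
        & forall g, g \in (factor_group f :&: K)%G -> commute g h].
      move: sT; rewrite mem_cat => /orP [/mapP [u uf ->]|/d1 [h hh [ch hW]]].
        exists (gprod gs u); split; [exact: word_in | exact: word_codes |].
        move=> g; rewrite inE => /andP[_ gK].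
        have /centP := subsetP cent g gK; apply.
        by rewrite mem_gen // inE map_f.
      exists h; split=> // g; rewrite inE => /andP[gf _].
      have hK : h \in K by rewrite mem_gen // inE.
      by apply/commute_sym; have /centP := subsetP cent h hK; apply.
    rewrite -ch //; split; first exact: (pt_lt act).
    move=> g gA; have gW : g \in W.
      by move: gA; rewrite inE => /andP[_ /(subsetP KW)].
    by rewrite -ch ?(pt_lt act) // -!(ptM act) //; congr (mv _ k); apply/esym/hH.
  move=> g k; rewrite inE => /andP[gf gK] ltk; apply/andP; split.
    apply: (orbits_closedP act _ _ ho1 gf ltk); first exact: factor_elts_in.
    move=> h /mapP [u uf ->]; exists (word_code u); first exact: map_f.
    exact: word_codes.
  apply: (orbits_closedP act _ _ ho2 gK ltk) => //.
  by move=> h /d2 [c cc [ch _]]; exists c.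
rewrite (dprodE cent ti) /= -cent_joinEr //.
apply/eqP; rewrite eqEsubset join_subG !gen_subG -andbA; apply/and3P; split.
- by apply/subsetP=> g; rewrite inE => gg; rewrite mem_gen // inE mem_cat gg.
- by apply/subsetP=> g; rewrite inE => gg; rewrite mem_gen // inE mem_cat gg orbT.
apply/subsetP=> g; rewrite inE mem_cat => /orP [] gg.
  by apply/(subsetP (joing_subl _ _)); rewrite mem_gen // inE.
by apply/(subsetP (joing_subr _ _)); rewrite mem_gen // inE.
Qed.

Lemma cert_checkP ct : cert_check ct ->
  let w := gprod gs (cert_word ct) in
  (exists Hs : seq {group gT},
    (\big[dprod/1]_(H <- Hs) (H : {set gT}) = 'C_W[w])%g /\
    forall H : {group gT}, H \in Hs -> reflection_group R H)
  /\ (#|'C_W[w]%g| <= N.to_nat (cert_bound ct))%N.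
Proof.
move=> + w; case/and4P; rewrite /cert_code => /allP hc hi hf hs.
have [d1 d2] := @flatten_factor (cert_factors ct) (fun c g => codes 27 mv c g /\ g \in W)
  (fun u => conj (word_codes u) (word_in u)).
have wW : w \in W by apply: word_in.
have cw g : g \in flatten (map factor_elts (cert_factors ct)) -> commute g w.
  move=> /d2 [c cc [cg gW]]; apply/commute_sym.
  exact: (codes_commute act wW gW (word_codes _) cg (hc _ cc)).
pose H := <<[set:: flatten (map factor_elts (cert_factors ct))]>>%G.
have eltsW : {subset flatten (map factor_elts (cert_factors ct)) <= W}.
  by move=> g /d2 [c _ []].
have sHC : H \subset 'C_W[w]%G.
  rewrite gen_subG; apply/subsetP=> g; rewrite inE => gg.
  by rewrite inE eltsW //=; apply/cent1P/cw.
have [|||sCH cC] := siftP act (subsetIl W 'C[w]) sHC _ _ _ hs => //.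
- move=> t /powers_codes [i ci] k ltk; rewrite -ci //.
  split; first by rewrite (pt_lt act) ?groupX ?word_in.
  move=> g; rewrite inE => /andP[gW /cent1P gw].
  rewrite -ci ?(pt_lt act) // -!(ptM act) ?groupX ?word_in //.
  by congr (mv _ k); apply/commute_sym/commuteX.
- move=> l p /mapP [l' _ ->] /mapP [v _ ->].
  exists (gprod (flatten (map factor_elts (cert_factors ct))) v); first exact: gprod_gen.
  apply: (codes_compose act) => //.
    rewrite /cert_gen_codes !size_flatten /shape -!map_comp; congr sumn.
    by apply: eq_map => f /=; rewrite !size_map.
  move=> i; rewrite /cert_gen_codes.
  have -> : flatten (map factor_elts (cert_factors ct))
      = [seq gprod gs u | u <- flatten (map factor_words (cert_factors ct))].
    by rewrite map_flatten -map_comp.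
  have -> : flatten (map factor_codes (cert_factors ct))
      = [seq word_code u | u <- flatten (map factor_words (cert_factors ct))].
    by rewrite map_flatten -map_comp.
  by rewrite size_map => lti; rewrite !(nth_map [::]) //; apply: word_codes.
have stab0 : stab mv 'C_W[w]%G [::] = 'C_W[w]%g.
  by apply/setP=> g; rewrite !inE andbT.
rewrite stab0 in sCH cC; split; last first.
  apply: leq_trans cC _; rewrite /cert_bound; elim: sift_sizes => [|d ds IH].
    by rewrite big_nil.
  by rewrite big_cons /= N2Nat.inj_mul Nat2N.id multE leq_mul2l IH orbT.
exists (map factor_group (cert_factors ct)); split.
  rewrite independentP //; apply/eqP; rewrite eqEsubset.
  by apply/andP; split.
have hall c : c \in cert_gen_codes ct -> exists2 h, h \in W & codes 27 mv c h.
  by move=> /d1 [h _ [ch hW]]; exists h.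
elim: (cert_factors ct) hf cw => [|f fs IH] //= /andP [hf hfs] cw K.
rewrite inE => /orP [/eqP ->|]; last first.
  by apply: IH => // g gg; apply: cw; rewrite mem_cat gg orbT.
by apply: (factor_checkP hall _ hf) => g gf; apply: cw; rewrite mem_cat gf.
Qed.

End Soundness.

(** * Conjugacy classes *)

Definition ct0 := Certificate [::] [::] [::].

Section ClassTable.
Variables (gT : finGroupType) (W : {group gT}).
Variables (mv : gT -> nat -> nat) (gs : seq gT).
Hypothesis act : point_action 27 E6_rel W mv.
Hypothesis size_gs : size gs = 6%N.
Hypothesis gen_gs : <<[set:: gs]>>%g = W.
Hypothesis codes_gs :
  forall i, (i < 6)%N -> codes 27 mv (nth [::] E6_gens i) (nth 1%g gs i).

Definition elt_displacement (g : gT) : nat * nat :=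
  (count (fun k => E6_rel k (mv g k) == 0%N) (iota 0 27),
   count (fun k => E6_rel k (mv g k) == 1%N) (iota 0 27)).

Lemma displacement_codes c g : codes 27 mv c g ->
  displacement c = elt_displacement g.
Proof.
move=> cg; congr (_, _); apply: eq_in_count => k;
  by rewrite mem_iota => /andP[_ ltk]; rewrite cg.
Qed.

(** Conjugation by x renumbers the lines by x, and x preserves the relation. *)
Lemma elt_displacementJ g x : g \in W -> x \in W ->
  elt_displacement (g ^ x)%g = elt_displacement g.
Proof.
move=> gW xW; have ltx k : (k < 27)%N -> (mv x k < 27)%N by apply: (pt_lt act).
have inj : {in iota 0 27 &, injective (mv x)}.
  move=> k l; rewrite !mem_iota => /andP[_ ltk] /andP[_ ltl] /(congr1 (mv x^-1%g)).
  by rewrite -!(ptM act) ?groupV // mulgV !(pt1 act).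
have pe : perm_eq (map (mv x) (iota 0 27)) (iota 0 27).
  rewrite uniq_perm ?map_inj_in_uniq ?iota_uniq //.
  apply: (uniq_min_size _ _ _).2; rewrite ?size_map //.
    by rewrite map_inj_in_uniq ?iota_uniq.
  by move=> _ /mapP [k + ->]; rewrite !mem_iota => /andP[_ ltk]; rewrite add0n ltx.
have e d : count (fun k => E6_rel k (mv (g ^ x)%g k) == d) (iota 0 27)
         = count (fun k => E6_rel k (mv g k) == d) (iota 0 27).
  rewrite -(seq.permP pe) count_map; apply: eq_in_count => k.
  rewrite mem_iota => /andP[_ ltk] /=.
  rewrite -(ptM act) ?groupJ //.
  by rewrite conjgE mulKVg (ptM act) // (pt_rel act) // (pt_lt act).
by rewrite /elt_displacement !e.
Qed.

Definition elt_invariant (g : gT) : seq (nat * nat) :=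
  [seq elt_displacement (g ^+ a)%g | a <- [:: 1; 2; 3]%N].

Lemma cert_invariantE ct : cert_invariant ct = elt_invariant (gprod gs (cert_word ct)).
Proof.
apply/eq_in_map => a ha; have lta : (a < 12)%N.
  by move: ha; rewrite !inE => /or3P [] /eqP ->.
rewrite (set_nth_default (iota 0 27)) ?size_traject // nth_traject //.
exact/displacement_codes/(iter_codes act size_gs gen_gs codes_gs).
Qed.

Lemma elt_invariantJ g x : g \in W -> x \in W -> elt_invariant (g ^ x)%g = elt_invariant g.
Proof.
move=> gW xW; apply: eq_map => a.
by rewrite -conjXg elt_displacementJ ?groupX.
Qed.

Lemma card_disjoint_classes (ws : seq gT) :
    {subset ws <= W} -> uniq (map elt_invariant ws) ->
  (\sum_(w <- ws) #|(w ^: W)%g| <=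
     #|[set g in W | has (fun w => g \in (w ^: W)%g) ws]|)%N.
Proof.
elim: ws => [|w ws IH] sW /=; first by rewrite big_nil.
case/andP => /mapP nw /IH {}IH; rewrite big_cons.
have wW : w \in W by apply: sW; rewrite mem_head.
have wsW : {subset ws <= W} by move=> v vs; apply: sW; rewrite inE vs orbT.
apply: leq_trans (leq_add (leqnn _) (IH wsW)) _.
rewrite -cardsUI [X in (_ + X)%N](_ : _ = 0%N) ?addn0.
  apply/subset_leq_card/subsetP=> g; rewrite !inE => /orP [gw|/andP[-> ->]].
    rewrite gw andbT; have /imsetP [x xW ->] := gw.
    exact: groupJ.
  by rewrite orbT.
apply/eqP; rewrite cards_eq0; apply/eqP/setP=> g; rewrite !inE.
apply/negP=> /and3P [/imsetP [x xW ->] _ /hasP [v vs /imsetP [y yW e]]].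
apply: nw; exists v => //.
by rewrite -(elt_invariantJ wW xW) e elt_invariantJ // wsW.
Qed.

(** With |C_W(w_i)| <= c_i the class of w_i has at least |W| / c_i elements; the
    sum over i is |W|, and the classes are disjoint. *)
Lemma class_table_complete n cts : n != 0%num ->
    class_table_check n cts ->
    (forall i, (i < size cts)%N -> let ct := nth ct0 cts i in
       (#|'C_W[gprod gs (cert_word ct)]%g| <= N.to_nat (cert_bound ct))%N) ->
  forall w, w \in W -> exists2 i, (i < size cts)%N
    & w \in (gprod gs (cert_word (nth ct0 cts i)) ^: W)%g.
Proof.
move=> nz /and4P [_ un hdvd hsum] hC w wW.
have n0 : (0 < N.to_nat n)%N 
  by rewrite lt0n; apply: contra nz => /eqP h; apply/eqP/N2Nat.inj.
pose ws := [seq gprod gs (cert_word ct) | ct <- cts].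
have wsW : {subset ws <= W}.
  rewrite /ws; elim: (cts) => [|ct l IH] v //=; rewrite inE => /orP [/eqP ->|/IH //].
  exact: word_in gen_gs _.
have uws : uniq (map elt_invariant ws).
  rewrite -map_comp; move: un; congr (is_true (uniq _)).
  by apply: eq_map => ct; apply: cert_invariantE.
have le : (#|W| <= \sum_(v <- ws) #|(v ^: W)%g|)%N.
  rewrite -(leq_pmul2l n0).
  have {1}-> : N.to_nat n = \sum_(ct <- cts) N.to_nat (N.div n (cert_bound ct)).
    rewrite -[in LHS](eqP hsum); elim: (cts) => [|ct l IH]; first by rewrite big_nil.
    by rewrite big_cons /= N2Nat.inj_add plusE IH.
  rewrite !big_map !(big_nth ct0) !big_mkord big_distrl big_distrr /=.
  apply: leq_sum => i _; set ct := nth _ _ _.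
  have /eqP/(congr1 N.to_nat) := all_nthP ct0 hdvd _ (ltn_ord i).
  rewrite -/ct N2Nat.inj_mul multE => <-.
  rewrite [leqLHS]mulnC [in leqRHS]mulnAC leq_mul2r; apply/orP; right.
  rewrite -index_cent1 -(Lagrange (subsetIl W 'C[gprod gs (cert_word ct)])).
  by rewrite leq_mul2r; apply/orP; right; apply: (hC i).
have WU : [set g in W | has (fun v => g \in (v ^: W)%g) ws] = W.
  apply/eqP; rewrite eqEcard; apply/andP; split.
    by apply/subsetP=> g; rewrite inE => /andP[].
  exact: leq_trans le (card_disjoint_classes wsW uws).
move: wW; rewrite -{1}WU inE => /andP[_ /(has_nthP 1%g) [i lti h]].
rewrite size_map in lti; exists i => //.
by rewrite -(nth_map ct0 1%g (fun ct => gprod gs (cert_word ct))).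
Qed.

End ClassTable.

(** Rather than conjugating subgroups and their representations, the certificate
    of w is read in the action twisted by x, where it speaks of w^x. *)
Lemma conjugate_action (gT : finGroupType) (W : {group gT})
    (mv : gT -> nat -> nat) (N : nat) rel (x : gT) : x \in W ->
  point_action N rel W mv -> point_action N rel W (fun g => mv (g ^ x^-1)%g).
Proof.
move=> xW [lt one mul pr faith]; have JW g : g \in W -> (g ^ x^-1)%g \in W.
  by move=> gW; rewrite groupJ ?groupV.
split=> [g k gW|k|g h k gW hW|g i j gW|g gW h].
- exact/lt/JW.
- by rewrite conj1g; apply: one.
- by rewrite conjMg; apply: mul; apply: JW.
- exact/pr/JW.
by rewrite -[g](conjgKV x) (faith _ (JW _ gW) h) conj1g.
Qed.

Lemma gprodJ (gT : finGroupType) (gs : seq gT) (x : gT) u :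
  gprod [seq (g ^ x)%g | g <- gs] u = (gprod gs u ^ x)%g.
Proof.
rewrite /gprod (big_morph (fun g => g ^ x)%g (fun g h => conjMg g h x) (conj1g x)).
apply: eq_bigr => i _; have [lti|gei] := ltnP i (size gs).
  by rewrite (nth_map 1%g).
by rewrite !nth_default ?size_map // conj1g.
Qed.

Lemma class_table_theorem (R : realType) (gT : finGroupType) (W : {group gT})
    (n : N) (cts : seq certificate) (w : gT) :
    n != 0%num -> class_table_check n cts -> weyl_group E6 W -> w \in W ->
  exists Hs : seq {group gT},
    (\big[dprod/1]_(H <- Hs) (H : {set gT}) = 'C_W[w])%g /\
    forall H : {group gT}, H \in Hs -> reflection_group R H.
Proof.
move=> n0 hcts /weyl_group_E6_lines [mv [gs [act sz gen cgs]]] wW.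
have /and4P [hall _ _ _] := hcts.
have hct i : (i < size cts)%N -> cert_check (nth ct0 cts i) by move/(all_nthP ct0 hall).
have [|i lti] := class_table_complete act sz gen cgs n0 hcts _ wW.
  by move=> i lti; have [_] := cert_checkP R act sz gen cgs (hct i lti).
case/imsetP => x xW ->; rewrite -gprodJ.
apply: (cert_checkP R (conjugate_action xW act) _ _ _ (hct i lti)).1.
- by rewrite size_map.
- have -> : [set:: [seq (g ^ x)%g | g <- gs]] = ([set:: gs] :^ x)%g.
    apply/setP=> g; rewrite mem_conjg !inE; apply/mapP/idP => [[h hgs ->]|hg].
      by rewrite conjgK.
    by exists (g ^ x^-1)%g; rewrite ?conjgKV.
  by rewrite genJ gen conjGid.
move=> j ltj k ltk; rewrite (nth_map 1%g) ?sz // conjgK.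
exact: cgs.
Qed.

(** * The 25 classes of the Weyl group *)

Definition real_vector : seq int -> seq coef := map (fun a => (a, 0)).

(** Restricts linear forms, in coordinates with respect to the simple roots, to
    the lines. *)
Definition on_lines (rows : seq (seq coef)) : seq (seq coef) :=
  [seq [seq cdot 0 f (real_vector c) | c <- E6_lines] | f <- rows].

Definition ComplexReflections (q : int) (rows : seq (seq coef))
    (gens : seq (seq nat * seq coef * seq coef)) : factor :=
  Reflections 0 q (on_lines rows) gens.

Definition real_generators (gens : seq (seq nat * seq int * seq int)) :
    seq (seq nat * seq coef * seq coef) :=
  [seq (x.1.1, real_vector x.1.2, real_vector x.2) | x <- gens].

Definition RealReflections (rows : seq (seq int))
    (gens : seq (seq nat * seq int * seq int)) : factor :=
  ComplexReflections 0 (map real_vector rows) (real_generators gens).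

(** All linear forms: the reflection representation of W itself, for subgroups
    generated by reflections of W. The rows r are then the roots, and the
    columns c minus the coroots. *)
Definition WeylReflections (gens : seq (seq nat * seq int * seq int)) : factor :=
  RealReflections [seq mkseq (fun j => (i == j)%:R) 6 | i <- iota 0 6] gens.

(** The rows are values on the 27 lines rather than linear forms. *)
Definition AffineReflections (rows : seq (seq int))
    (gens : seq (seq nat * seq int * seq int)) : factor :=
  Reflections 3 1 (map real_vector rows) (real_generators gens).

(** For each Carter class a representative w and the factors of its centraliser,
    in the order in which they are listed. *)
Definition E6_certificates : seq certificate := ([::
  (* A class of one element: W itself. *)
  Certificate [::]%N
    [:: (26, [:: [:: 5]; [:: 4]; [:: 3]; [:: 1]; [:: 2]; [:: 0]]);
        (25, [:: [:: 4]; [:: 3]; [:: 1]; [:: 2]; [:: 0]]);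
        (24, [:: [:: 3]; [:: 1]; [:: 2]; [:: 0]]);
        (17, [:: [:: 0]; [:: 2]]);
        (20, [:: [:: 1]]);
        (23, [:: [:: 2]])]%N
    [:: WeylReflections [:: ([:: 0]%N, [:: -2; 0; 1; 0; 0; 0], [:: 1; 0; 0; 0; 0; 0]);
          ([:: 1]%N, [:: 0; -2; 0; 1; 0; 0], [:: 0; 1; 0; 0; 0; 0]);
          ([:: 2]%N, [:: 1; 0; -2; 1; 0; 0], [:: 0; 0; 1; 0; 0; 0]);
          ([:: 3]%N, [:: 0; 1; 1; -2; 1; 0], [:: 0; 0; 0; 1; 0; 0]);
          ([:: 4]%N, [:: 0; 0; 0; 1; -2; 1], [:: 0; 0; 0; 0; 1; 0]);
          ([:: 5]%N, [:: 0; 0; 0; 0; 1; -2], [:: 0; 0; 0; 0; 0; 1])]];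
  (* A_1: S_6 and Z_2. *)
  Certificate [:: 1]%N
    [:: (26, [:: [:: 3]; [:: 2]; [:: 1]; [:: 0]; [:: 4]]);
        (25, [:: [:: 2]; [:: 1]; [:: 0]; [:: 4]]);
        (9, [:: [:: 5]]);
        (23, [:: [:: 0]; [:: 1]]);
        (21, [:: [:: 1]])]%N
    [:: WeylReflections [:: ([:: 2]%N, [:: 1; 0; -2; 1; 0; 0], [:: 0; 0; 1; 0; 0; 0]);
          ([:: 0]%N, [:: -2; 0; 1; 0; 0; 0], [:: 1; 0; 0; 0; 0; 0]);
          ([:: 3; 1; 2; 3; 4; 3; 1; 2; 3]%N, [:: 1; 0; 0; -1; 0; 1], [:: 0; 1; 1; 2; 1; 0]);
          ([:: 5]%N, [:: 0; 0; 0; 0; 1; -2], [:: 0; 0; 0; 0; 0; 1]);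
          ([:: 4]%N, [:: 0; 0; 0; 1; -2; 1], [:: 0; 0; 0; 0; 1; 0])];
        Cyclic [:: 1]%N];
  (* 2 A_1: S_4 and W(B_2), on the (-1)-eigenspace of w. *)
  Certificate [:: 4; 3; 1; 2; 3; 4; 5; 4; 3; 1; 2; 3; 4; 5]%N
    [:: (20, [:: [:: 2]; [:: 1]; [:: 0]; [:: 4]; [:: 3]]);
        (22, [:: [:: 0]; [:: 1]]);
        (26, [:: [:: 3]]);
        (24, [:: [:: 1]])]%N
    [:: WeylReflections [:: ([:: 2]%N, [:: 1; 0; -2; 1; 0; 0], [:: 0; 0; 1; 0; 0; 0]);
          ([:: 3]%N, [:: 0; 1; 1; -2; 1; 0], [:: 0; 0; 0; 1; 0; 0]);
          ([:: 1]%N, [:: 0; -2; 0; 1; 0; 0], [:: 0; 1; 0; 0; 0; 0])];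
        RealReflections
        [:: [:: 0; 1; 1; 2; 2; 0];
            [:: 0; 0; 0; 0; 0; 1]]
        [:: ([:: 5]%N, [:: 2; -2], [:: 0; 1]);
            ([:: 1; 2; 3; 1; 2; 3; 4; 3; 1; 2; 3; 4]%N, [:: -2; 1], [:: 1; 0])]];
  (* A_2: Z_3 and S_3 wr Z_2 acting on the nine lines fixed by w, on which the
     first row is 1 and the other two are coordinates. *)
  Certificate [:: 3; 1]%N
    [:: (24, [:: [:: 0]; [:: 3]; [:: 1]; [:: 2]]);
        (21, [:: [:: 1]; [:: 3; 2; 3]]);
        (20, [:: [:: 3; 2; 3]]);
        (26, [:: [:: 2]])]%N
    [:: Cyclic [:: 3; 1]%N;
        AffineReflections
        [:: [:: 1; 1; 0; 0; 0; 0; 0; 0; 0; 0; 1; 0; 1; 1; 1; 1; 0; 0; 0; 0; 0; 0; 0; 0; 0; 1; 1];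
            [:: 0; 0; 0; 0; 0; 0; 0; 0; 0; 0; 1; 0; 1; 2; 0; 2; 0; 0; 0; 0; 0; 0; 0; 0; 0; 1; 2];
            [:: 0; 1; 0; 0; 0; 0; 0; 0; 0; 0; 0; 0; 1; 0; 2; 1; 0; 0; 0; 0; 0; 0; 0; 0; 0; 2; 2]]
        [:: ([:: 0]%N, [:: 0; 0; 1], [:: 1; 0; 1]);
            ([:: 5]%N, [:: 0; 1; 0], [:: 0; 1; 0]);
            ([:: 1; 2; 3; 1; 2; 3; 4; 3; 1; 2; 3; 4]%N, [:: 0; 1; -1], [:: 0; -1; 1])]];
  (* A_2 + A_1: S_3 and Z_6. *)
  Certificate [:: 0; 1; 2]%N
    [:: (23, [:: [:: 2]]);
        (26, [:: [:: 1]; [:: 0]]);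
        (25, [:: [:: 0]])]%N
    [:: WeylReflections [:: ([:: 4]%N, [:: 0; 0; 0; 1; -2; 1], [:: 0; 0; 0; 0; 1; 0]);
          ([:: 5]%N, [:: 0; 0; 0; 0; 1; -2], [:: 0; 0; 0; 0; 0; 1])];
        Cyclic [:: 0; 1; 2]%N];
  (* 3 A_1: Z_2 and W(B_3), on the (-1)-eigenspace of w. *)
  Certificate [:: 1; 2; 4]%N
    [:: (25, [:: [:: 0]; [:: 2]; [:: 3]; [:: 1]]);
        (26, [:: [:: 3]]);
        (20, [:: [:: 3; 1; 3]]);
        (23, [:: [:: 1]])]%N
    [:: WeylReflections [:: ([:: 3; 1; 2; 3; 4; 3; 1; 2; 3]%N, [:: 1; 0; 0; -1; 0; 1], [:: 0; 1; 1; 2; 1; 0])];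
        RealReflections
        [:: [:: 0; 1; 0; 0; 0; 0];
            [:: 0; 0; 1; 0; 0; 0];
            [:: 0; 0; 0; 0; 1; 0]]
        [:: ([:: 2]%N, [:: 0; -2; 0], [:: 0; 1; 0]);
            ([:: 0; 2; 3; 1; 4; 3; 2; 0]%N, [:: -1; 0; 1], [:: 1; 0; -1]);
            ([:: 5; 4; 3; 1; 2; 3; 4; 5]%N, [:: -1; 1; 0], [:: 1; -1; 0])]];
  (* A_3: Z_4 and W(B_2), on the space fixed by w. *)
  Certificate [:: 3; 1; 2]%N
    [:: (24, [:: [:: 0]]);
        (22, [:: [:: 2]]);
        (20, [:: [:: 2; 1; 2]]);
        (26, [:: [:: 1]])]%N
    [:: Cyclic [:: 3; 1; 2]%N;
        RealReflections
        [:: [:: 2; 0; 1; 0; -1; 0];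
            [:: 0; 1; 1; 2; 2; 0];
            [:: 0; 0; 0; 0; 0; 1]]
        [:: ([:: 5]%N, [:: -1; 2; -2], [:: 0; 0; 1]);
            ([:: 4; 3; 1; 2; 3; 4]%N, [:: 2; -2; 1], [:: 0; 1; 0])]];
  (* A_4: Z_10. *)
  Certificate [:: 0; 1; 2; 3]%N
    [:: (24, [:: [:: 0]]);
        (26, [:: [:: 0; 0; 0; 0; 0]])]%N
    [:: Cyclic [:: 0; 1; 2; 3; 5]%N];
  (* A_2 + 2 A_1: Z_3 and W(B_2), on the (-1)-eigenspace of w. *)
  Certificate [:: 0; 1; 2; 4]%N
    [:: (23, [:: [:: 0]; [:: 1]; [:: 2]]);
        (25, [:: [:: 2; 1; 2]])]%N
    [:: Cyclic [:: 0; 2]%N;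
        RealReflections
        [:: [:: 0; 1; 0; 0; 0; 0];
            [:: 0; 0; 0; 0; 1; 0]]
        [:: ([:: 1]%N, [:: -2; 0], [:: 1; 0]);
            ([:: 0; 2; 0; 3; 1; 2; 0; 3; 2; 4; 3; 1; 2; 0; 3; 2; 4; 3]%N, [:: -1; 1], [:: 1; -1])]];
  (* A_3 + A_1: Z_4, Z_2 and Z_2. *)
  Certificate [:: 0; 1; 3; 4]%N
    [:: (25, [:: [:: 0]; [:: 2]]);
        (21, [:: [:: 1]])]%N
    [:: Cyclic [:: 1; 3; 4]%N;
        Cyclic [:: 0]%N;
        Cyclic [:: 2; 0; 3; 1; 2; 3; 4; 3; 1; 2; 0; 3; 2]%N];
  (* 2 A_2: S_3 and G(3,1,2), on an eigenspace of w for a cube root of unity. *)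
  Certificate [:: 3; 2; 0; 4; 3; 1; 2; 3; 4; 5; 4; 3; 1; 2; 0; 3; 2; 4; 3; 1; 5; 4]%N
    [:: (23, [:: [:: 1]; [:: 0]; [:: 3]; [:: 2]]);
        (17, [:: [:: 0]; [:: 2]])]%N
    [:: WeylReflections [:: ([:: 0]%N, [:: -2; 0; 1; 0; 0; 0], [:: 1; 0; 0; 0; 0; 0]);
          ([:: 2]%N, [:: 1; 0; -2; 1; 0; 0], [:: 0; 0; 1; 0; 0; 0])];
        ComplexReflections 1
        [:: [:: (1, 0); (2, 1); (2, 0); (3, 0); (0, 0); (1, 2)];
            [:: (0, 0); (0, 0); (0, 0); (0, 0); (1, 0); (0, -1)]]
        [:: ([:: 5; 4]%N, [:: (2, -2); (-1, 1)], [:: (0, 0); (1, 0)]);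
            ([:: 0; 2; 0; 3; 1; 2; 0; 3; 2; 4; 3; 1; 2; 0; 3; 2; 4; 3]%N, [:: (-1, 2); (0, -1)], [:: (1, 0); (1, -1)])]];
  (* D_4: Z_6 and S_3, on the (-1)-eigenspace of w. *)
  Certificate [:: 1; 2; 4; 3]%N
    [:: (10, [:: [:: 0]; [:: 1]; [:: 2]]);
        (25, [:: [:: 2]])]%N
    [:: Cyclic [:: 1; 2; 4; 3]%N;
        RealReflections
        [:: [:: 0; 1; 0; 0; -1; 0];
            [:: 0; 0; 1; 0; -1; 0]]
        [:: ([:: 5; 4; 3; 1; 2; 3; 4; 5]%N, [:: -1; 1], [:: 1; -1]);
            ([:: 0; 2; 3; 1; 4; 3; 2; 0]%N, [:: -2; -1], [:: 1; 0])]];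
  (* D_5: Z_8. *)
  Certificate [:: 0; 1; 2; 3; 4]%N
    [:: (25, [:: [:: 0]])]%N
    [:: Cyclic [:: 0; 1; 2; 3; 4]%N];
  (* A_4 + A_1: Z_10. *)
  Certificate [:: 0; 1; 2; 3; 5]%N
    [:: (15, [:: [:: 0]])]%N
    [:: Cyclic [:: 0; 1; 2; 3; 5]%N];
  (* 2 A_2 + A_1: Z_6 and S_3, on an eigenspace of w for a cube root of unity. *)
  Certificate [:: 2; 0; 3; 1; 2; 3; 4; 3; 1; 2; 0; 3; 2; 5; 4; 3; 1; 2; 0; 3; 2; 4; 3; 5; 4]%N
    [:: (26, [:: [:: 0]; [:: 1]]);
        (25, [:: [:: 0; 0; 2; 1]])]%N
    [:: Cyclic [:: 2; 0; 3; 1; 2; 3; 4; 3; 1; 2; 0; 3; 2; 5; 4; 3; 1; 2; 0; 3; 2; 4; 3; 5; 4]%N;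
        ComplexReflections 1
        [:: [:: (1, 0); (0, 0); (0, -1); (1, -1); (1, 0); (0, -1)];
            [:: (0, 0); (1, 0); (1, 0); (2, 1); (1, 1); (1, 1)]]
        [:: ([:: 0; 1; 5]%N, [:: (-2, -1); (1, 0)], [:: (1, 0); (0, 1)]);
            ([:: 1; 3; 1; 2; 0; 4; 3; 1; 2; 5; 4; 3; 1]%N, [:: (0, 0); (0, 1)], [:: (1, 0); (2, 2)])]];
  (* A_5: Z_6 and Z_2. *)
  Certificate [:: 5; 4; 3; 1; 2; 0; 3; 2; 4; 3; 1]%N
    [:: (24, [:: [:: 0]; [:: 1]])]%N
    [:: Cyclic [:: 5; 4; 3; 1; 2; 0; 3; 2; 4; 3; 1]%N;
        Cyclic [:: 2; 3; 2]%N];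
  (* E_6, the Coxeter class: Z_12. *)
  Certificate [:: 0; 1; 2; 3; 4; 5]%N
    [:: (26, [:: [:: 0]])]%N
    [:: Cyclic [:: 0; 1; 2; 3; 4; 5]%N];
  (* D_4(a_1): G_8, on the eigenspace of w for i. *)
  Certificate [:: 1; 2; 3; 1; 4; 3]%N
    [:: (25, [:: [:: 0]; [:: 1]]);
        (26, [:: [:: 1]]);
        (20, [:: [:: 1; 1]])]%N
    [:: ComplexReflections 0
        [:: [:: (0, 0); (1, 0); (0, 0); (0, 0); (0, 1); (0, 0)];
            [:: (0, 0); (0, 0); (1, 0); (1, 1); (1, 0); (0, 0)]]
        [:: ([:: 0; 1; 2; 3; 1; 4; 3; 2; 0]%N, [:: (-1, 1); (1, 0)], [:: (1, 0); (0, 0)]);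
            ([:: 1; 3; 1; 5; 4; 3; 1; 2; 3; 4; 5]%N, [:: (-1, 0); (1, 0)], [:: (1, 0); (0, -1)])]];
  (* D_5(a_1): Z_12. *)
  Certificate [:: 0; 1; 2; 3; 1; 4; 3]%N
    [:: (25, [:: [:: 0]])]%N
    [:: Cyclic [:: 0; 1; 2; 3; 1; 4; 3]%N];
  (* E_6(a_1): Z_9. *)
  Certificate [:: 0; 1; 2; 3; 1; 4; 3; 5]%N
    [:: (26, [:: [:: 0]])]%N
    [:: Cyclic [:: 0; 1; 2; 3; 1; 4; 3; 5]%N];
  (* E_6(a_2): G_5, on an eigenspace of w for a sixth root of unity. *)
  Certificate [:: 1; 2; 3; 1; 2; 3; 4; 3; 2; 0; 5; 4]%N
    [:: (26, [:: [:: 1]; [:: 0]]);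
        (25, [:: [:: 0]])]%N
    [:: ComplexReflections 1
        [:: [:: (1, 0); (0, 0); (1, -1); (0, -2); (0, -1); (1, 0)];
            [:: (0, 0); (1, 0); (0, 0); (1, 1); (1, 1); (0, 0)]]
        [:: ([:: 1; 3; 4; 3]%N, [:: (0, -2); (-1, 1)], [:: (0, 0); (1, 0)]);
            ([:: 2; 3; 2; 0; 4; 3; 2; 5]%N, [:: (-1, 1); (1, 0)], [:: (1, 0); (0, 0)])]];
  (* 4 A_1: W(F_4), on the (-1)-eigenspace of w. *)
  Certificate [:: 1; 2; 3; 1; 2; 3; 4; 3; 1; 2; 3; 4]%N
    [:: (25, [:: [:: 2]; [:: 0]; [:: 1]; [:: 3]]);
        (20, [:: [:: 0]; [:: 1]; [:: 3]]);
        (24, [:: [:: 1]; [:: 3; 0; 3]]);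
        (23, [:: [:: 3; 0; 3]])]%N
    [:: RealReflections
        [:: [:: 0; 1; 0; 0; 0; 0];
            [:: 0; 0; 1; 0; 0; 0];
            [:: 0; 0; 0; 1; 0; 0];
            [:: 0; 0; 0; 0; 1; 0]]
        [:: ([:: 1]%N, [:: -2; 0; 1; 0], [:: 1; 0; 0; 0]);
            ([:: 3]%N, [:: 1; 1; -2; 1], [:: 0; 0; 1; 0]);
            ([:: 0; 2; 3; 1; 4; 3; 2; 0]%N, [:: -1; 0; 0; 1], [:: 1; 0; 0; -1]);
            ([:: 5; 4; 3; 1; 2; 3; 4; 5]%N, [:: -1; 1; 0; 0], [:: 1; -1; 0; 0])]];
  (* A_3 + 2 A_1: S_4 and Z_4. *)
  Certificate [:: 0; 1; 2; 3; 1; 2; 3; 4; 3; 1; 2; 3; 4]%N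
    [:: (25, [:: [:: 2]; [:: 1]; [:: 0]; [:: 3]]);
        (24, [:: [:: 1]; [:: 0]]);
        (23, [:: [:: 0]])]%N
    [:: WeylReflections [:: ([:: 1]%N, [:: 0; -2; 0; 1; 0; 0], [:: 0; 1; 0; 0; 0; 0]);
          ([:: 3]%N, [:: 0; 1; 1; -2; 1; 0], [:: 0; 0; 0; 1; 0; 0]);
          ([:: 4]%N, [:: 0; 0; 0; 1; -2; 1], [:: 0; 0; 0; 0; 1; 0])];
        Cyclic [:: 0; 1; 2; 3; 1; 2; 3; 4; 3; 1; 2; 3; 4]%N];
  (* A_5 + A_1: S_3 and Z_6. *)
  Certificate [:: 0; 1; 2; 3; 1; 2; 3; 4; 3; 1; 2; 3; 4; 5]%N
    [:: (24, [:: [:: 1]; [:: 0]; [:: 2]]);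
        (23, [:: [:: 0]])]%N
    [:: WeylReflections [:: ([:: 1]%N, [:: 0; -2; 0; 1; 0; 0], [:: 0; 1; 0; 0; 0; 0]);
          ([:: 3]%N, [:: 0; 1; 1; -2; 1; 0], [:: 0; 0; 0; 1; 0; 0])];
        Cyclic [:: 0; 1; 2; 3; 1; 2; 3; 4; 3; 1; 2; 3; 4; 5]%N];
  (* 3 A_2: G_25, on an eigenspace of w for a cube root of unity. *)
  Certificate [:: 0; 1; 2; 3; 2; 0; 4; 3; 1; 2; 0; 3; 4; 5; 4; 3; 1; 2; 0; 3; 2; 4; 3; 5]%N
    [:: (26, [:: [:: 2]; [:: 1]; [:: 0]]);
        (25, [:: [:: 1]; [:: 0]]);
        (23, [:: [:: 0]])]%N
    [:: ComplexReflections 1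
        [:: [:: (1, 0); (0, 0); (1, 1); (0, 0); (0, 0); (0, 0)];
            [:: (0, 0); (1, 0); (1, 0); (2, 1); (0, 0); (0, -1)];
            [:: (0, 0); (0, 0); (0, 0); (0, 0); (1, 0); (1, 1)]]
        [:: ([:: 0; 2]%N, [:: (-1, 1); (1, 0); (0, 0)], [:: (1, 0); (0, 0); (0, 0)]);
            ([:: 1; 2; 3; 1; 2; 3; 4; 3]%N, [:: (0, -1); (-2, 0); (1, 0)], [:: (0, 0); (1, 0); (1, 1)]);
            ([:: 4; 5]%N, [:: (0, 0); (2, 0); (-1, 1)], [:: (0, 0); (0, 0); (1, 0)])]]])%Z.

Lemma E6_certificates_check : class_table_check 51840%num E6_certificates.
Proof. by vm_compute. Qed.

Theorem theorem1 (R : realType) (gT : finGroupType) (W : {group gT})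
    (hW : weyl_group E6 W) (w : gT) (hw : w \in W) :
  exists Hs : seq {group gT},
    (\big[dprod/1]_(H <- Hs) (H : {set gT}) = 'C_W[w])%g /\
    forall H : {group gT}, H \in Hs -> reflection_group R H.
Proof.
(* The arguments are explicit so that unification does not evaluate the check. *)
exact (@class_table_theorem R gT W 51840%num E6_certificates w isT
  E6_certificates_check hW hw).
Qed.
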